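(* For every continuous function $\varphi:\mathbb{C}\to\mathbb{C}$ such that $\psi(t):=|\varphi(e^{it})|^2$ belongs to $\Phi$, there exist a number $\gamma>0$ and a weight $\widetilde V$ with $\inf_{|t|\ge\gamma}\int_0^1\psi(ts)\widetilde V(s)\,ds\ge\mathcal{I}(\psi)$ such that for every $x\in H$ and every $\sigma>0$ $$E_\sigma(x)\le\frac{1}{\sqrt{\mathcal{I}(\psi)}}\;\omega_\varphi\!\left(x;L_{p,\widetilde V}\!\left(\left[0,\tfrac{\gamma}{\sigma}\right]\right)\right)\qquad(2\le p\le\infty),$$ and in particular $$E_\sigma(x)\le\frac{1}{\sqrt{\mathcal{I}(\psi)}}\;\omega_\varphi\!\left(x;\tfrac{\gamma}{\sigma}\right).$$
   Context: $H$ is a complex Hilbert space with norm $\|\cdot\|$. $E$ is a resolution of the identity on the Borel $\sigma$-algebra of $\mathbb{R}$ in $H$: to each Borel set $\beta$ is assigned an orthogonal projection $E(\beta)$ in $H$, with $E(\emptyset)=0$, $E(\mathbb{R})=I$, and $E(\bigcup_j\beta_j)=\sum_jE(\beta_j)$ (strongly) for pairwise disjoint sequences of Borel sets. $dE(t)$ denotes integration with respect to this projection-valued measure. For $\sigma>0$ put $W_\sigma=\{\int_{|t|<\sigma}dE(t)g: g\in H\}$ and $E_\sigma(x)=\inf_{h\in W_\sigma}\|x-h\|$. $\Phi$ is the set of continuous nonnegative $2\pi$-periodic functions $\psi:\mathbb{R}\to\mathbb{R}$ with nowhere dense zero set and $\psi(0)=0$; $\mathcal{I}(\psi)=\frac1{2\pi}\int_0^{2\pi}\psi(t)\,dt$.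 For $x\in H$, $t\in\mathbb{R}$ put $\Delta_t^\varphi x=\int_{-\infty}^{\infty}\varphi(e^{its})\,dE(s)x$. A weight is a nonnegative integrable function $V$ on $[0,1]$ that is nonzero on a set of full measure, normalized by $\int_0^1V(t)\,dt=1$. For $\delta>0$ and $1\le p<\infty$, $$\omega_\varphi(x;L_{p,V}([0,\delta]))=\left(\frac1\delta\int_0^\delta\|\Delta_t^\varphi x\|^p\,V\!\left(\frac t\delta\right)dt\right)^{1/p},$$ and for $p=\infty$ this quantity is understood as $\omega_\varphi(x;\delta)=\omega_\varphi(x;C([0,\delta]))=\max_{0\le t\le\delta}\|\Delta_t^\varphi x\|$. *)

(* Defs.v *)
From HB Require Import structures.
From mathcomp Require Import all_boot all_order all_algebra.
From mathcomp Require Import sesquilinear complex.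
From mathcomp Require Import all_classical all_reals all_analysis.

Set Implicit Arguments.
Unset Strict Implicit.
Unset Printing Implicit Defensive.

Import Order.TTheory GRing.Theory Num.Theory Num.Def.
Import numFieldNormedType.Exports.

Local Open Scope classical_set_scope.
Local Open Scope ring_scope.

(** * Periodic functions and weights *)

Section real_functions.
Variable R : realType.
Implicit Types (psi V : R -> R).

Definition nowhere_dense (T : topologicalType) (A : set T) : Prop :=
  (closure A)° = set0.

Definition in_Phi psi : Prop :=
  [/\ continuous psi,
      forall t, 0 <= psi t,
      forall t, psi (t + 2 * pi) = psi t,
      nowhere_dense [set t | psi t = 0] &
      psi 0 = 0].

Definition mean psi : R :=
  (2 * pi)^-1 * \int[lebesgue_measure]_(t in `[0, 2 * pi]) psi t.

(* Only the values of V on [0, 1] matter. *)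
Definition is_weight V : Prop :=
  [/\ forall t, t \in `[0, 1] -> 0 <= V t,
      lebesgue_measure.-integrable `[0, 1] (EFin \o V),
      {ae lebesgue_measure, forall t, t \in `[0, 1] -> V t != 0} &
      \int[lebesgue_measure]_(t in `[0, 1]) V t = 1].

(* e^{it} *)
Definition cis (t : R) : R[i] := (cos t +i* sin t)%C.

(* |phi(e^{it})|^2 *)
Definition sq_symbol (phi : R[i] -> R[i]) (t : R) : R :=
  (complex.Re `|phi (cis t)|) ^+ 2.

End real_functions.

(** * Spectral integrals *)

Section hilbert.
Variable R : realType.
Variable H : completeNormedModType R[i].
Implicit Types (dot : {dot H for conjC}) (E : set R -> {linear H -> H}).
Implicit Types (x y : H) (f s : R -> R[i]).

(* The norm of H takes its values in R[i], where it is real; this is the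
   same norm, with values in R. *)
Definition hnorm x : R := complex.Re `|x|.

(* The complete norm of H is the one of the inner product dot. *)
Definition is_hilbert dot : Prop := forall x, `|x| ^+ 2 = dot x x.

Definition orthogonal_projection dot (P : {linear H -> H}) : Prop :=
  (forall x, P (P x) = P x) /\ (forall x y, dot (P x) y = dot x (P y)).

(* Nothing is required of E outside the Borel sets. *)
Definition resolution_of_identity dot E : Prop :=
  [/\ forall A, measurable A -> orthogonal_projection dot (E A),
      forall x, E set0 x = 0,
      forall x, E setT x = x &
      forall F : (set R)^nat, (forall n, measurable (F n)) -> trivIset setT F ->
        forall x, (fun n => \sum_(k < n) E (F k) x) @ \oo
                    --> E (\bigcup_n F n) x].

Definition borel_simple s : Prop :=
  finite_set (range s) /\ forall c, measurable (s @^-1` [set c]).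

Definition simple_spectral_int E s x : H :=
  \sum_(c \in range s) c *: E (s @^-1` [set c]) x.

(* y is the integral of the bounded Borel function f against dE(t) x: the limit
   of the integrals of simple functions converging uniformly to f. *)
Definition is_spectral_int E f x y : Prop :=
  exists s_ : nat -> R -> R[i],
    [/\ forall n, borel_simple (s_ n),
        forall e : R, 0 < e ->
          \forall n \near \oo, forall t, `|s_ n t - f t| <= e%:C%C &
        (fun n => simple_spectral_int E (s_ n) x) @ \oo --> y].

(* \int_D f(t) dE(t) x; the default value 0 is never taken when f is bounded
   and Borel and D is Borel. *)
Definition spectral_int E (D : set R) f x : H :=
  xget 0 [set y | is_spectral_int E (patch (cst 0) D f) x y].

(** * Best approximation and moduli of continuity *)

Definition W E (sigma : R) : set H :=
  range (spectral_int E [set t | `|t| < sigma] (cst 1)).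

Definition best_approx E sigma x : R :=
  inf [set hnorm (x - h) | h in W E sigma].

(* Delta_t^phi x *)
Definition gen_diff E (phi : R[i] -> R[i]) (t : R) x : H :=
  spectral_int E setT (fun u : R => phi (cis (t * u))) x.

(* omega_phi(x; delta); the supremum is a maximum, since the norm of
   Delta_t^phi x is continuous in t. *)
Definition modulus E phi x (delta : R) : R :=
  sup [set hnorm (gen_diff E phi t x) | t in `[0, delta]].

(* omega_phi(x; L_{p,V}([0, delta])); the value for p = -oo is irrelevant. *)
Definition modulus_Lp E phi x (p : \bar R) (V : R -> R) (delta : R) : R :=
  match p with
  | q%:E => (delta^-1 * \int[lebesgue_measure]_(t in `[0, delta])
                          (hnorm (gen_diff E phi t x) `^ q * V (t / delta)))
              `^ q^-1
  | +oo%E => modulus E phi x delta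
  | -oo%E => 0
  end.

End hilbert.

(* Main.v *)
Require Import Defs.
From HB Require Import structures.
From mathcomp Require Import all_boot all_order all_algebra.
From mathcomp Require Import sesquilinear complex finmap.
From mathcomp Require Import all_classical all_reals all_analysis.
From mathcomp Require Import measurable_realfun ring lra.

Set Implicit Arguments.
Unset Strict Implicit.
Unset Printing Implicit Defensive.

Import Order.TTheory GRing.Theory Num.Theory Num.Def.
Import numFieldNormedType.Exports.

Local Open Scope classical_set_scope.
Local Open Scope ring_scope.

(** Write [f = psi - I(psi)], so that [f] has mean zero and [f 0 < 0], and let
    [f_j] be its iterated mean-zero periodic primitives. For the polynomial
    weight [V s = c s^(2m-1) (1-s)^(2m)], which vanishes to order [2m-1] at 0 and
    to higher order at 1, integrating by parts [2m] times gives
    [u^(2m) int_0^1 f(us) V(s) ds = c (2m-1)! f_(2m)(0) + O(1/|u|)], so the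
    weighted averages of [psi] are at least [I(psi)] for large [|u|] as soon as
    [f_(2m)(0) > 0]. Such an [m] exists: the cosine coefficients [a_k] of [f] do not
    all vanish (Fejer), those of [f_(2m)] are [(-1)^m a_k / k^(2m)], and for large
    [m] the first nonzero one decides the sign, which alternates with [m].

    On the Hilbert space side, [mu_x(A) = |E(A) x|^2] is a finite measure with
    [|Delta_t x|^2 = int psi(ts) dmu_x(s)], and [E_sigma(x)^2 <= mu_x(|s| >= sigma)].
    Averaging over [t] against [V] and exchanging the integrals gives the case
    [p = 2]; Jensen's inequality gives [p > 2]. *)

(** For any weight the averages [int psi(us) V(s) ds] tend to [I(psi)] as [|u|] grows
    (Riemann-Lebesgue), but this alone would only give the estimate with a constant slightly larger
    than [1 / sqrt I(psi)]. The exact constant requires averages that are nowhere below the mean for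
    [|u| >= gamma], so the difficulty is the sign of the leading term of the deviation. Against a
    general weight, integration by parts produces at the endpoint 1 terms in [f_j(u)], which
    oscillate with [u] and have no sign. A zero of order [2m] there removes them, while the zero of
    order one less at 0 leaves a single term, constant in [u]. The even number of integrations keeps
    [u^(2m)] positive for negative [u] as well. Since [psi] is merely continuous, its Fourier series
    may diverge at 0; only Cesaro means of the partial sums are used. The scale
    [delta = gamma / sigma] is chosen so that [|s| >= sigma] means [|delta s| >= gamma]. *)

(** * Integrals and primitives of continuous functions *)

Section integrals_of_continuous_functions.
Variable R : realType.
Implicit Types (f g h F G : R -> R) (a b c x : R).

Local Notation mu := (@lebesgue_measure R).

Lemma continuous_is_derive F f :
  (forall x, is_derive x 1 F (f x)) -> continuous F.
Proof.
move=> dF x; apply/differentiable_continuous/derivable1_diffP.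
by case: (dF x).
Qed.

Lemma continuous_integrable f a b :
  continuous f -> mu.-integrable `[a, b] (EFin \o f).
Proof.
move=> cf; apply: continuous_compact_integrable; first exact: segment_compact.
exact: continuous_subspaceT.
Qed.

Lemma RintegralD_continuous f g a b : continuous f -> continuous g ->
  \int[mu]_(t in `[a, b]) (f t + g t) =
  \int[mu]_(t in `[a, b]) f t + \int[mu]_(t in `[a, b]) g t.
Proof. by move=> cf cg; rewrite RintegralD//; exact: continuous_integrable. Qed.

Lemma RintegralB_continuous f g a b : continuous f -> continuous g ->
  \int[mu]_(t in `[a, b]) (f t - g t) =
  \int[mu]_(t in `[a, b]) f t - \int[mu]_(t in `[a, b]) g t.
Proof. by move=> cf cg; rewrite RintegralB//; exact: continuous_integrable. Qed.

Lemma RintegralZ_continuous c f a b : continuous f ->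
  \int[mu]_(t in `[a, b]) (c * f t) = c * \int[mu]_(t in `[a, b]) f t.
Proof. by move=> cf; rewrite RintegralZl//; exact: continuous_integrable. Qed.

Lemma Rintegral_segment_cst c a b : a <= b ->
  \int[mu]_(t in `[a, b]) c = c * (b - a).
Proof.
move=> ab; rewrite Rintegral_cst//= lebesgue_measure_itv/= lte_fin.
case: ltP => //= ba; have -> : b = a by apply/le_anti; rewrite ba.
by rewrite subrr.
Qed.

Lemma le_Rintegral_continuous f g a b : continuous f -> continuous g ->
  (forall t, t \in `[a, b] -> f t <= g t) ->
  \int[mu]_(t in `[a, b]) f t <= \int[mu]_(t in `[a, b]) g t.
Proof.
by move=> cf cg fg; apply: le_Rintegral => //; exact: continuous_integrable.
Qed.

Lemma Rintegral_le_cst f M a b : a <= b -> continuous f ->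
  (forall t, t \in `[a, b] -> `|f t| <= M) ->
  `|\int[mu]_(t in `[a, b]) f t| <= M * (b - a).
Proof.
move=> ab cf fM; apply: (le_trans (le_normr_Rintegral _ _)) => //.
  exact: continuous_integrable.
rewrite -Rintegral_segment_cst//; apply: le_Rintegral_continuous => //.
  by move=> x; apply: (@cvg_norm _ _ _ _ _ f); exact: cf.
by move=> x; exact: cvg_cst.
Qed.

Lemma Rintegral_is_derive F f a b : a <= b -> continuous f ->
  (forall x, is_derive x 1 F (f x)) ->
  \int[mu]_(t in `[a, b]) f t = F b - F a.
Proof.
rewrite le_eqVlt => /predU1P[-> _ _|ab cf dF].
  by rewrite set_itv1 Rintegral_set1 subrr.
have cF := continuous_is_derive dF.
rewrite /Rintegral (@continuous_FTC2 _ f F)//.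
- exact: continuous_subspaceT.
- split=> [x _||]; first by case: (dF x).
  + exact/cvg_at_right_filter/cF.
  + exact/cvg_at_left_filter/cF.
- by move=> x _; rewrite derive1E; case: (dF x).
Qed.

Lemma continuous_primitive f : continuous f ->
  exists F, forall x, is_derive x 1 F (f x).
Proof.
move=> cf.
pose I a b := \int[mu]_(t in `[a, b]) f t.
exists (fun x => I 0 x - I x 0) => x0.
(* A base point to the left of both 0 and [x0]: near [x0] the oriented integral is [I a x] up to a
   constant, and the fundamental theorem applies to [I a]. *)
pose a := - (`|x0| + 1).
have a0 : a < 0 by rewrite oppr_lt0 ltr_wpDl.
have split a' b c : a' <= b -> b <= c -> I a' c = I a' b + I b c.
  move=> ab bc; have := @Rintegral_itvB _ f (BLeft a') (BRight c) b.
  rewrite !bnd_simp => /(_ (continuous_integrable a' c cf) ab bc).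
  rewrite Rintegral_itv_obnd_cbnd; last first.
    apply: integrableS (continuous_integrable b c cf) => //.
    exact: subset_itv_oc_cc.
  by move=> /eqP; rewrite subr_eq addrC => /eqP.
have E x : a < x -> I a x - I a 0 = I 0 x - I x 0.
  move=> ax; have [x0'|x0'] := leP 0 x.
    rewrite (split a 0 x)//; last exact: ltW.
    rewrite addrAC subrr add0r; move: x0'; rewrite le_eqVlt => /predU1P[<-|x0'].
      by rewrite /I set_itv1 Rintegral_set1 subr0.
    by rewrite [X in _ = _ - X]/I set_itv_ge ?bnd_simp -?ltNge// Rintegral_set0 subr0.
  rewrite (split a x 0) ?(ltW ax) ?(ltW x0')//.
  rewrite opprD addrA subrr sub0r.
  by rewrite [I 0 x]/I set_itv_ge ?bnd_simp -?ltNge// Rintegral_set0 sub0r.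
have ax0 : a < x0.
  by rewrite /a ltrNl (le_lt_trans (ler_norm _))// normrN ltrDl.
apply: (@near_eq_is_derive _ _ _ (fun x => I a x - I a 0)).
  near=> x; apply: E; near: x.
  exact: lt_nbhsr.
have xu : x0 < x0 + 1 by rewrite ltrDl.
have [dI Ix] : derivable (I a) x0 1 /\ derive1 (I a) x0 = f x0.
  exact: continuous_FTC1_closed xu (continuous_integrable a (x0 + 1) cf) ax0 (cf x0).
have dIa : is_derive x0 1 (I a) (f x0) by split; rewrite -?derive1E.
have := is_deriveB dIa (is_derive_cst (I a 0) x0 1).
by rewrite subr0.
Unshelve. all: by end_near. Qed.

End integrals_of_continuous_functions.

(** * Periodic functions of mean zero and their primitives *)

Section zero_mean_periodic_functions.
Variable R : realType.
Implicit Types (f g h F G : R -> R) (a b c x : R).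

Local Notation mu := (@lebesgue_measure R).

Lemma continuous_mul f g : continuous f -> continuous g ->
  continuous (fun x => f x * g x).
Proof. by move=> cf cg x; apply: continuousM; [exact: cf | exact: cg]. Qed.

Lemma continuous_add f g : continuous f -> continuous g ->
  continuous (fun x => f x + g x).
Proof. by move=> cf cg x; apply: continuousD; [exact: cf | exact: cg]. Qed.

Lemma continuous_sub f g : continuous f -> continuous g ->
  continuous (fun x => f x - g x).
Proof. by move=> cf cg x; apply: continuousB; [exact: cf | exact: cg]. Qed.

Lemma continuous_normr f : continuous f -> continuous (fun x => `|f x|).
Proof. by move=> cf x; apply: (@cvg_norm _ _ _ _ _ f); exact: cf. Qed.

Lemma continuous_const c : continuous (fun _ : R => c).
Proof. by move=> x; exact: cvg_cst. Qed.

Lemma continuous_scale_arg c f : continuous f -> continuous (fun x => f (c * x)).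
Proof.
move=> cf x; apply: (@continuous_comp _ _ _ ( *%R c) f); last exact: cf.
exact: mulrl_continuous.
Qed.

Lemma is_derive_fun_mul F G a b x : is_derive x 1 F a -> is_derive x 1 G b ->
  is_derive x 1 (fun t => F t * G t) (a * G x + F x * b).
Proof.
move=> dF dG; have := is_deriveM dF dG; rewrite /GRing.scale/= => H.
by rewrite (_ : a * G x + F x * b = F x * b + G x * a); [exact: H | ring].
Qed.

Lemma is_derive_fun_add F G a b x : is_derive x 1 F a -> is_derive x 1 G b ->
  is_derive x 1 (fun t => F t + G t) (a + b).
Proof. exact: is_deriveD. Qed.

Lemma is_derive_fun_scale c F a x : is_derive x 1 F a ->
  is_derive x 1 (fun t => c * F t) (c * a).
Proof. exact: is_deriveZ. Qed.

Lemma is_derive_scale_arg c F a x :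
  is_derive (c * x) 1 F a -> is_derive x 1 (fun t => F (c * t)) (c * a).
Proof.
move=> dF.
have dc : is_derive x 1 (fun t : R => c * t) c.
  have := is_deriveZ c (is_derive_id x 1); rewrite /GRing.scale/= mulr1.
  by move=> H; exact: H.
have := is_derive1_comp dF dc; rewrite mulrC.
by move=> H; exact: H.
Qed.

Definition zero_mean_periodic f := [/\ continuous f, periodic f (2 * pi) &
  \int[mu]_(t in `[0, 2 * pi]) f t = 0].

Let twopi_ge0 : 0 <= 2 * pi :> R.
Proof. by rewrite mulr_ge0// pi_ge0. Qed.

Let twopi_gt0 : 0 < 2 * pi :> R.
Proof. by rewrite mulr_gt0// pi_gt0. Qed.

Lemma periodic_int f c : periodic f c -> forall (n : int) x, f (x + c *~ n) = f x.
Proof.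
move=> pf [] n x; first by rewrite periodicn.
by rewrite NegzE mulrNz -pmulrn -[in RHS](subrK (c *+ n.+1) x) periodicn.
Qed.

Lemma periodic_segment f : periodic f (2 * pi) ->
  forall x, exists2 y, y \in `[0, 2 * pi] & f x = f y.
Proof.
move=> pf x; pose n := Num.floor (x / (2 * pi)).
exists (x - (2 * pi) *~ n); last first.
  by rewrite -[in LHS](subrK ((2 * pi) *~ n) x) periodic_int.
have := @floor_le R (x / (2 * pi)); have := @floorD1_gt R (x / (2 * pi)).
rewrite -/n ltr_pdivrMr// ler_pdivlMr// intrD -mulrzl => h1 h2.
rewrite in_itv/=; apply/andP; split; lra.
Qed.

Lemma periodic_bounded f : continuous f -> periodic f (2 * pi) ->
  exists2 M, 0 <= M & forall x, `|f x| <= M.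
Proof.
move=> cf pf.
have cnf : {within `[0, 2 * pi], continuous (fun x => `|f x|)}.
  apply: continuous_subspaceT => x.
  by apply: (@cvg_norm _ _ _ _ _ f); exact: cf.
have [c _ fc] := EVT_max twopi_ge0 cnf.
exists `|f c| => // x.
by have [y y02 ->] := periodic_segment pf x; exact: fc.
Qed.

(** The increment of a primitive over one period is constant and equals the integral of [f] over a
    period, so mean zero is exactly what makes the primitive periodic. Subtracting its own mean
    restores mean zero, and the construction can be iterated. *)
Lemma zero_mean_periodic_primitive f : zero_mean_periodic f ->
  exists F, zero_mean_periodic F /\ forall x, is_derive x 1 F (f x).
Proof.
move=> [cf pf f0].
have [F dF] := continuous_primitive cf.
have cF := continuous_is_derive dF.
pose m := (2 * pi)^-1 * \int[mu]_(t in `[0, 2 * pi]) F t.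
have dFm x : is_derive x 1 (fun t => F t - m) (f x).
  by have := is_deriveB (dF x) (is_derive_cst m x 1); rewrite subr0; exact.
have ccst := @continuous_const m.
exists (fun x => F x - m); split => //; split.
- exact: continuous_is_derive dFm.
- move=> x; congr (_ - m); apply/eqP; rewrite -subr_eq0; apply/eqP.
  have -> : F (x + 2 * pi) - F x = F (0 + 2 * pi) - F 0.
    apply: (@is_derive_0_is_cst _ (fun t => F (t + 2 * pi) - F t)) => t.
    rewrite -(subrr (f t)); apply: is_deriveB => //.
    have /= := @is_derive_shift _ t 1 (2 * pi).
    move=> ds; have := @is_derive1_comp _ F (+%R^~ (2 * pi)) t _ _ (dF (t + 2 * pi)) ds.
    by rewrite mulr1 pf; exact.
  by rewrite add0r -(Rintegral_is_derive twopi_ge0 cf dF).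
- rewrite RintegralB_continuous// Rintegral_segment_cst// subr0 /m.
  by rewrite mulrAC mulVf ?gt_eqF// mul1r subrr.
Qed.

Lemma zero_mean_periodic_primitives f : zero_mean_periodic f ->
  exists h : nat -> R -> R, [/\ h 0%N = f,
    forall n, zero_mean_periodic (h n) &
    forall n x, is_derive x 1 (h n.+1) (h n x)].
Proof.
move=> zf.
have next (g : {g | zero_mean_periodic g}) :
    {G : {g | zero_mean_periodic g} | forall x, is_derive x 1 (sval G) (sval g x)}.
  case: g => g zg; apply: cid.
  by have [G [zG dG]] := zero_mean_periodic_primitive zg; exists (exist _ G zG).
pose s n := iter n (fun g : {g | zero_mean_periodic g} => sval (next g)) (exist _ f zf).
exists (fun n => sval (s n)); split => // n; first exact: svalP (s n).
exact: (svalP (next (s n))).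
Qed.

(** * Cosine coefficients and the Fejer kernel *)

Definition cos_coef (k : nat) f : R :=
  \int[mu]_(t in `[0, 2 * pi]) (f t * cos (k%:R * t)).

Lemma cos_coef0 f : cos_coef 0 f = \int[mu]_(t in `[0, 2 * pi]) f t.
Proof. by apply: eq_Rintegral => t _; rewrite mul0r cos0 mulr1. Qed.

Lemma cos_natM2pi k : cos (k%:R * (2 * pi)) = 1 :> R.
Proof.
elim: k => [|k IH]; first by rewrite mul0r cos0.
by rewrite -natr1 mulrDl mul1r [X in _ + X]mulr_natl cosD2pi.
Qed.

Lemma sin_natM2pi k : sin (k%:R * (2 * pi)) = 0 :> R.
Proof.
elim: k => [|k IH]; first by rewrite mul0r sin0.
by rewrite -natr1 mulrDl mul1r [X in _ + X]mulr_natl sinD2pi.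
Qed.

Lemma cos_coef_primitive2 k f g h :
  zero_mean_periodic f -> zero_mean_periodic g -> zero_mean_periodic h ->
  (forall x, is_derive x 1 g (f x)) -> (forall x, is_derive x 1 h (g x)) ->
  cos_coef k f = - k%:R ^+ 2 * cos_coef k h.
Proof.
move=> [cf pf _] [cg pg _] [ch ph _] dg dh.
pose c := k%:R : R.
have cc : continuous (fun t : R => cos (c * t)).
  exact: continuous_scale_arg (@continuous_cos R).
have dc (t : R) : is_derive t 1 (fun t : R => cos (c * t)) (c * - sin (c * t)).
  exact: is_derive_scale_arg.
have ds (t : R) : is_derive t 1 (fun t : R => sin (c * t)) (c * cos (c * t)).
  exact: is_derive_scale_arg.
(* Two integrations by parts in one: the function differentiated here takes equal values at 0 and
   [2 * pi], so its derivative integrates to zero. *)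
have dH (t : R) : is_derive t 1 (fun t => g t * cos (c * t) + c * (h t * sin (c * t)))
    (f t * cos (c * t) + c ^+ 2 * (h t * cos (c * t))).
  have := is_derive_fun_add (is_derive_fun_mul (dg t) (dc t))
    (is_derive_fun_scale c (is_derive_fun_mul (dh t) (ds t))).
  congr (is_derive _ _ _ _); ring.
have chc := continuous_mul ch cc.
have cZ : continuous (fun t => c ^+ 2 * (h t * cos (c * t))).
  exact: continuous_mul (@continuous_const _) chc.
have := Rintegral_is_derive twopi_ge0 _ dH.
rewrite RintegralD_continuous ?RintegralZ_continuous//; last exact: continuous_mul.
rewrite -/(cos_coef k f) -/(cos_coef k h) cos_natM2pi sin_natM2pi !mulr0 cos0 sin0.
rewrite !mulr0 !mulr1 !addr0.
have -> : g (2 * pi) = g 0 by rewrite -[2 * pi]add0r pg.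
rewrite subrr => H; apply/eqP; rewrite -subr_eq0 mulNr opprK; apply/eqP/H.
by apply: continuous_add; [exact: continuous_mul | exact: cZ].
Qed.

Lemma cos_coef_bound k f M : continuous f -> (forall x, `|f x| <= M) ->
  `|cos_coef k f| <= M * (2 * pi).
Proof.
move=> cf fM; rewrite -[2 * pi in leRHS]subr0; apply: Rintegral_le_cst => //.
  by apply: continuous_mul => //; exact: continuous_scale_arg (@continuous_cos R).
move=> t _; rewrite normrM -[M]mulr1.
by apply: ler_pM => //; exact: cos_max.
Qed.

Lemma cos_coef_iterated_primitive (h : nat -> R -> R) :
  (forall n, zero_mean_periodic (h n)) ->
  (forall n x, is_derive x 1 (h n.+1) (h n x)) ->
  forall k m, cos_coef k (h 0%N) =
    (-1) ^+ m * k%:R ^+ m.*2 * cos_coef k (h m.*2).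
Proof.
move=> zh dh k; elim=> [|m ->]; first by rewrite !mul1r.
rewrite (cos_coef_primitive2 (h := h m.+1.*2) k (zh _) (zh _) (zh _) (dh _) (dh _)).
by rewrite doubleS !exprS; ring.
Qed.

Definition dirichlet n x : R := 1 + 2 * \sum_(k < n) cos (k.+1%:R * x).

(** [N] times the usual Fejer kernel: a sum rather than a mean of Dirichlet kernels. *)
Definition fejer N x : R := \sum_(n < N) dirichlet n x.

Lemma dirichletE n x :
  (1 - cos x) * dirichlet n x = cos (n%:R * x) - cos (n.+1%:R * x).
Proof.
rewrite /dirichlet; elim: n => [|n IH].
  by rewrite big_ord0 mul0r mul1r cos0 mulr0 addr0 mulr1.
rewrite big_ord_recr/= [2 * _]mulrDr addrA mulrDr IH -(natr1 n.+1).
have -> : n%:R * x = n.+1%:R * x - x by rewrite -natr1; ring.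
by rewrite [(_ + 1) * x]mulrDl mul1r cosB cosD; ring.
Qed.

(** Multiplication by [1 - cos x] turns each Dirichlet kernel into a difference of consecutive
    cosines, and the sum telescopes. This replaces the usual quotient of sines, which is undefined
    at multiples of [2 * pi]. *)
Lemma fejerE N x : (1 - cos x) * fejer N x = 1 - cos (N%:R * x).
Proof.
rewrite /fejer; elim: N => [|N IH].
  by rewrite big_ord0 mulr0 mul0r cos0 subrr.
by rewrite big_ord_recr/= mulrDr IH dirichletE; ring.
Qed.

Lemma cos_eq1_natM k x : cos x = 1 -> cos (k%:R * x) = 1.
Proof.
move=> c1; have s1 : sin x = 0.
  by apply/eqP; rewrite -sqrf_eq0 sin2cos2 c1 expr1n subrr.
suff [] : cos (k%:R * x) = 1 /\ sin (k%:R * x) = 0 by [].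
elim: k => [|k [IHc IHs]]; first by rewrite mul0r cos0 sin0.
rewrite -natr1 mulrDl mul1r cosD sinD IHc IHs c1 s1.
by rewrite !mulr0 !mulr1 subr0 addr0.
Qed.

(** The closed form decides the sign unless [cos x = 1]; there every cosine in the kernel equals
    1. *)
Lemma fejer_ge0 N x : 0 <= fejer N x.
Proof.
have [c1|c1] := eqVneq (cos x) 1.
  apply: sumr_ge0 => n _; rewrite addr_ge0// mulr_ge0// sumr_ge0// => k _.
  by rewrite cos_eq1_natM.
have c0 : 0 < 1 - cos x by rewrite subr_gt0 lt_neqAle c1 cos_le1.
by rewrite -(pmulr_rge0 _ c0) fejerE subr_ge0 cos_le1.
Qed.

Lemma continuous_sum_fun n (F : 'I_n -> R -> R) :
  (forall i, continuous (F i)) -> continuous (fun x => \sum_i F i x).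
Proof.
elim: n F => [|n IH] F cF.
  by under eq_fun do rewrite big_ord0; exact: continuous_const.
under eq_fun do rewrite big_ord_recr/=.
by apply: continuous_add; [exact: IH | exact: cF].
Qed.

Lemma Rintegral_sum_continuous n (F : 'I_n -> R -> R) a b :
  (forall i, continuous (F i)) ->
  \int[mu]_(t in `[a, b]) (\sum_i F i t) = \sum_i \int[mu]_(t in `[a, b]) F i t.
Proof.
elim: n F => [|n IH] F cF.
  rewrite big_ord0; under eq_Rintegral do rewrite big_ord0.
  by rewrite Rintegral_cst//= mul0r.
under eq_Rintegral do rewrite big_ord_recr/=.
rewrite RintegralD_continuous ?big_ord_recr/= ?IH//.
exact: continuous_sum_fun.
Qed.

Lemma continuous_dirichlet n : continuous (dirichlet n).
Proof.
apply: continuous_add; first exact: continuous_const.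
apply: continuous_mul; first exact: continuous_const.
by apply: continuous_sum_fun => i; exact: continuous_scale_arg (@continuous_cos R).
Qed.

Lemma continuous_fejer N : continuous (fejer N).
Proof. by apply: continuous_sum_fun => i; exact: continuous_dirichlet. Qed.

(** This is [2 * pi] times the value at 0 of the [n]-th partial sum of the Fourier series of [f];
    the sine terms vanish there. *)
Definition cos_partial_sum f n : R :=
  cos_coef 0 f + 2 * \sum_(k < n) cos_coef k.+1 f.

Lemma Rintegral_fejer f N : continuous f ->
  \int[mu]_(t in `[0, 2 * pi]) (f t * fejer N t) =
  \sum_(n < N) cos_partial_sum f n.
Proof.
move=> cf; have ck k : continuous (fun t => f t * cos (k%:R * t)).
  by apply: continuous_mul => //; exact: continuous_scale_arg (@continuous_cos R).
under eq_Rintegral do rewrite mulr_sumr.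
rewrite Rintegral_sum_continuous => [|i]; last first.
  by apply: continuous_mul => //; exact: continuous_dirichlet.
apply: eq_bigr => n _.
transitivity (\int[mu]_(t in `[0, 2 * pi])
    (f t * cos (0%:R * t) + 2 * \sum_(k < n) f t * cos (k.+1%:R * t))).
  apply: eq_Rintegral => t _; rewrite /dirichlet mul0r cos0 mulr1.
  by rewrite mulrDr mulr1 mulrCA mulr_sumr.
rewrite RintegralD_continuous//; last first.
  apply: continuous_mul; first exact: continuous_const.
  exact: continuous_sum_fun.
rewrite RintegralZ_continuous; last exact: continuous_sum_fun.
by rewrite Rintegral_sum_continuous.
Qed.

End zero_mean_periodic_functions.

(** * Fejer summation at 0 and the sign of iterated primitives *)

Section sign_of_iterated_primitives.
Variable R : realType.
Implicit Types (f g h : R -> R) (x : R).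

Local Notation mu := (@lebesgue_measure R).

Let twopi_gt0 : 0 < 2 * pi :> R.
Proof. by rewrite mulr_gt0// pi_gt0. Qed.

Let twopi_ge0 := ltW twopi_gt0.

Lemma Rintegral_1subcos k :
  \int[mu]_(t in `[0, 2 * pi]) (1 - cos (k.+1%:R * t)) = 2 * pi :> R.
Proof.
pose c : R := k.+1%:R.
have cc : continuous (fun t : R => cos (c * t)).
  exact: continuous_scale_arg (@continuous_cos R).
rewrite RintegralB_continuous//; last exact: continuous_const.
rewrite Rintegral_segment_cst// subr0 mul1r.
have dS (t : R) : is_derive t 1 (fun t => c^-1 * sin (c * t)) (cos (c * t)).
  rewrite -[X in is_derive _ _ _ X](mulKf (_ : c != 0)) ?pnatr_eq0//.
  by apply: is_derive_fun_scale; exact: is_derive_scale_arg.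
rewrite (Rintegral_is_derive twopi_ge0 cc dS) sin_natM2pi !mulr0 sin0.
by rewrite mulr0 subrr subr0.
Qed.

Lemma Rintegral_fejer1 N : \int[mu]_(t in `[0, 2 * pi]) fejer N t = N%:R * (2 * pi) :> R.
Proof.
transitivity (\int[mu]_(t in `[0, 2 * pi]) (cst 1 t * fejer N t) : R).
  by apply: eq_Rintegral => t _; rewrite mul1r.
rewrite Rintegral_fejer; last exact: continuous_const.
rewrite (eq_bigr (fun=> 2 * pi)) => [|n _]; first by rewrite sumr_const card_ord [RHS]mulr_natl.
rewrite /cos_partial_sum cos_coef0 Rintegral_segment_cst// subr0 mul1r big1 ?mulr0 ?addr0//.
move=> k _; have := Rintegral_1subcos k.
rewrite RintegralB_continuous; last 2 first.
- exact: continuous_const.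
- exact: continuous_scale_arg (@continuous_cos R).
rewrite Rintegral_segment_cst// subr0 mul1r /cos_coef.
under [in X in _ -> X]eq_Rintegral do rewrite mul1r.
by move=> /eqP; rewrite subr_eq addrC -subr_eq subrr eq_sym => /eqP.
Qed.

(* Near the endpoints of the period [|g - g 0|] is small by continuity, elsewhere
   [1 - cos] is bounded away from 0. *)
Lemma oscillation_le_1subcos g e : continuous g -> periodic g (2 * pi) -> 0 < e ->
  exists2 C, 0 <= C &
    forall x, x \in `[0, 2 * pi] -> `|g x - g 0| <= e + C * (1 - cos x).
Proof.
move=> cg pg e0.
have [M M0 gM] := periodic_bounded cg pg.
have /cvgrPdist_le/(_ _ e0) := cg 0 => /nbhs_ballP[d /= d0 gd].
pose r := Order.min (d / 2) (pi / 2).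
have r0 : 0 < r by rewrite lt_min !divr_gt0// pi_gt0.
have rd : r < d by rewrite gt_min ltr_pdivrMr// ltr_pMr// ltr1n.
have rpi : r < pi.
  by rewrite gt_min [X in _ || X](_ : _ = true) ?orbT// ltr_pdivrMr// ltr_pMr ?pi_gt0// ltr1n.
have cr : cos r < 1.
  by rewrite -[ltRHS]cos0 ltr_cos// in_itv/= ?lexx ?pi_ge0// (ltW r0) (ltW rpi).
have near y : `|y| <= r -> `|g y - g 0| <= e.
  move=> yr; rewrite distrC; apply: gd; rewrite /ball/= sub0r normrN.
  exact: le_lt_trans rd.
have far y : r <= y <= pi -> cos y <= cos r.
  move=> /andP[ry ypi].
  by rewrite leNgt ltr_cos -?leNgt// in_itv/= ?ypi ?(ltW r0) ?(ltW rpi)// (le_trans (ltW r0)).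
(* [M + M] bounds the oscillation of [g], and [1 - cos r] bounds [1 - cos x] from below at distance
   at least [r] from the endpoints. *)
pose C := (M + M) / (1 - cos r).
have c0 : 0 < 1 - cos r by rewrite subr_gt0.
have C0 : 0 <= C by apply: divr_ge0 (ltW c0); exact: addr_ge0.
exists C => // x; rewrite in_itv/= => /andP[x0 x2].
have small : `|g x - g 0| <= e -> `|g x - g 0| <= e + C * (1 - cos x).
  move=> /le_trans; apply; rewrite lerDl mulr_ge0// subr_ge0; exact: cos_le1.
have big : cos x <= cos r -> `|g x - g 0| <= e + C * (1 - cos x).
  move=> xr; apply: (@le_trans _ _ (M + M)).
    by rewrite (le_trans (ler_normB _ _))// lerD.
  apply: ler_wpDl; first exact: ltW.
  rewrite -[leLHS](divfK (_ : 1 - cos r != 0)) ?gt_eqF//.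
  by apply: ler_wpM2l => //; exact: lerB.
have [xr|rx] := leP x r; first by apply/small/near; rewrite ger0_norm.
have [xp|px] := leP x pi; first by apply/big/far; rewrite (ltW rx).
have cx : cos x = cos (2 * pi - x) by rewrite cosB mulr_natl cos2pi sin2pi mul1r mul0r addr0.
have [xr|rx'] := leP (2 * pi - x) r.
  apply: small; rewrite -[x](subrK (2 * pi)) pg; apply: near.
  by rewrite distrC ger0_norm// subr_ge0.
apply: big; rewrite cx; apply: far; rewrite (ltW rx')/=; lra.
Qed.

(** Multiplied by the kernel, the far part [C * (1 - cos x)] of the oscillation bound becomes
    [C * (1 - cos (N x))], whose integral does not grow with [N]. After division by [N] this is
    Fejer's theorem at the point 0. *)
Lemma fejer_approximation g e : continuous g -> periodic g (2 * pi) -> 0 < e ->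
  exists C, forall N,
    `|\sum_(n < N) cos_partial_sum g n - N%:R * (2 * pi) * g 0|
      <= e * (N%:R * (2 * pi)) + C.
Proof.
move=> cg pg e0; have [C C0 gC] := oscillation_le_1subcos cg pg e0.
exists (C * (2 * pi)) => -[|N].
  by rewrite big_ord0 !mul0r mulr0 subr0 normr0 add0r mulr_ge0.
have cF := @continuous_fejer R N.+1.
have c0F := continuous_mul (@continuous_const _ (g 0)) cF.
have cgF := continuous_mul cg cF.
have cN : continuous (fun t : R => 1 - cos (N.+1%:R * t)).
  apply: continuous_sub; first exact: continuous_const.
  exact: (continuous_scale_arg (@continuous_cos R)).
have cR : continuous (fun t : R => e * fejer N.+1 t + C * (1 - cos (N.+1%:R * t))).
  by apply: continuous_add; apply: continuous_mul => //; exact: continuous_const.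
have -> : \sum_(n < N.+1) cos_partial_sum g n - N.+1%:R * (2 * pi) * g 0 =
    \int[mu]_(t in `[0, 2 * pi]) (g t * fejer N.+1 t - g 0 * fejer N.+1 t).
  by rewrite RintegralB_continuous// Rintegral_fejer// RintegralZ_continuous// Rintegral_fejer1 [g 0 * _]mulrC.
have -> : e * (N.+1%:R * (2 * pi)) + C * (2 * pi) =
    \int[mu]_(t in `[0, 2 * pi]) (e * fejer N.+1 t + C * (1 - cos (N.+1%:R * t))).
  rewrite RintegralD_continuous; last 2 first.
  - by apply: continuous_mul => //; exact: continuous_const.
  - by apply: continuous_mul => //; exact: continuous_const.
  by rewrite !RintegralZ_continuous// Rintegral_fejer1 Rintegral_1subcos.
have cB := continuous_sub cgF c0F.
apply: (le_trans (le_normr_Rintegral _ _)) => //; first exact: continuous_integrable.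
apply: le_Rintegral_continuous => // [|t t2]; first exact: continuous_normr cB.
rewrite -mulrBl normrM (ger0_norm (fejer_ge0 _ _)) -fejerE mulrA -mulrDl.
by apply: ler_wpM2r; [exact: fejer_ge0 | exact: gC].
Qed.

(** The partial sums themselves need not converge, but their Cesaro means tend to [2 * pi * g 0],
    and the first [p] of them have no influence on the limit. *)
Lemma partial_sums_lower_bound g d p : continuous g -> periodic g (2 * pi) ->
  (forall n, 0 <= cos_partial_sum g n) ->
  (forall n, (p <= n)%N -> d <= cos_partial_sum g n) ->
  d <= 2 * pi * g 0.
Proof.
move=> cg pg s0 sd; rewrite leNgt; apply/negP => dg.
move: twopi_gt0 (fun e => @fejer_approximation g e cg pg) dg.
move: (2 * pi) => T T0 fejer_approx dg.
(* Half of the gap: [T * g 0 + e * T] is the midpoint between [T * g 0] and [d], so the lower bound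
   outgrows the upper one linearly in [m]. *)
pose e := (d - T * g 0) / (2 * T).
have e0 : 0 < e by rewrite divr_gt0 ?mulr_gt0// subr_gt0.
have eE : 2 * (e * T) = d - T * g 0 by rewrite /e; field; rewrite gt_eqF.
have [C HC] := fejer_approx _ e0.
have low m : m%:R * d <= \sum_(n < p + m) cos_partial_sum g n.
  rewrite big_split_ord/= -[leLHS]add0r lerD ?sumr_ge0//.
  rewrite -[m in leLHS]card_ord mulr_natl -sumr_const ler_sum// => i _.
  by apply: sd; rewrite leq_addr.
pose D := T * g 0 + e * T.
have dD : 0 < d - D by rewrite /D; lra.
have bound m : m%:R * (d - D) <= p%:R * D + C.
  have := HC (p + m)%N; rewrite ler_norml => /andP[_].
  have := low m; rewrite natrD /D; lra.
have := bound (Num.truncn ((p%:R * D + C) / (d - D))).+1.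
by rewrite leNgt -ltr_pdivrMr// truncnS_gt.
Qed.

(** The first nonzero term outweighs the tail: the sum of [1 / j^2] over [j > p] is at most [1 / p],
    so the later terms can cost at most [d] out of [2 * d]. *)
Lemma sum_inverse_squares_tail (a : nat -> R) (p : nat) (d : R) :
  (0 < p)%N -> 0 <= d ->
  (forall j, (0 < j < p)%N -> a j = 0) ->
  2 * d <= a p ->
  (forall j, (p < j)%N -> `|a j| <= d * p%:R / j%:R ^+ 2) ->
  (forall n, 0 <= \sum_(k < n) a k.+1) /\
  (forall n, (p <= n)%N -> d <= \sum_(k < n) a k.+1).
Proof.
move=> p0 d0 az ap aj.
have S0 n : (n < p)%N -> \sum_(k < n) a k.+1 = 0.
  by move=> np; rewrite big1// => k _; rewrite az//= (leq_ltn_trans _ np).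
(* The surplus [d p / (p + n)] strengthens the induction: it pays for the terms still to come, since
   [1/q - 1/(q+1) >= 1/(q+1)^2]. *)
have Sp n : d + d * p%:R / (p + n)%:R <= \sum_(k < p + n) a k.+1.
  elim: n => [|n IH].
    case: p p0 {az aj} ap S0 => [//|p] _ ap S0.
    rewrite addn0 big_ord_recr/= S0// add0r mulfK ?pnatr_eq0//; lra.
  rewrite addnS big_ord_recr/=.
  have := aj (p + n).+1; rewrite ltnS leq_addr => /(_ isT).
  rewrite ler_norml => /andP[+ _]; move: IH.
  set q : R := (p + n)%:R; have q0 : 0 < q by rewrite ltr0n addn_gt0 p0.
  rewrite -natr1 -/q.
  have key : d * p%:R / (q + 1) <= d * p%:R / q - d * p%:R / (q + 1) ^+ 2.
    rewrite -!mulrBr; apply: ler_wpM2l; first by rewrite mulr_ge0.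
    rewrite -subr_ge0 (_ : _ - _ = (q * (q + 1) ^+ 2)^-1).
      by rewrite invr_ge0 mulr_ge0 ?sqr_ge0// ltW.
    by field; lra.
  lra.
split=> [n|n pn].
  have [np|pn] := ltnP n p; first by rewrite S0.
  rewrite -(subnKC pn); apply: le_trans (Sp _).
  by rewrite addr_ge0// divr_ge0// mulr_ge0.
rewrite -(subnKC pn); apply: le_trans (Sp _).
by rewrite lerDl divr_ge0// mulr_ge0.
Qed.

(* The cosine coefficients of the 2m-th primitive are [(-1)^m a_k / k^(2m)]: for
   large [m] the first nonvanishing one decides, and its sign alternates. *)
Lemma iterated_primitive_gt0 (h : nat -> R -> R) :
  (forall n, zero_mean_periodic (h n)) ->
  (forall n x, is_derive x 1 (h n.+1) (h n x)) ->
  h 0%N 0 < 0 -> exists m, 0 < h m.+1.*2 0.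
Proof.
move=> zh dh h0.
pose c k := cos_coef k (h 0%N).
have [c0 p0 zm0] := zh 0%N.
have [k ck] : exists k, c k.+1 != 0.
  apply: contrapT => /forallNP c_eq0.
  have cz k : c k.+1 = 0 by have /negP := c_eq0 k; rewrite negbK => /eqP.
  have s n : cos_partial_sum (h 0%N) n = 0.
    by rewrite /cos_partial_sum cos_coef0 zm0 add0r big1 ?mulr0// => i _; exact: cz.
  (* If all cosine coefficients vanished, all partial sums at 0 would be zero and Fejer summation
     would contradict [h 0 0 < 0]. *)
  have : 0 <= 2 * pi * h 0%N 0.
    by apply: (@partial_sums_lower_bound _ _ 0) => // n; rewrite s.
  by rewrite pmulr_rge0// leNgt h0.
have [p /andP[p_gt0 cp] pmin] : exists2 p, ((0 < p)%N && (c p != 0)) &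
    forall j, (0 < j < p)%N -> c j = 0.
  have ex : exists p, ((0 < p)%N && (c p != 0)) by exists k.+1.
  case: (ex_minnP ex) => p pP pmin; exists p => // j /andP[j0 jp].
  apply/eqP; apply: contraTT jp => cj; rewrite -leqNgt.
  by apply: pmin; rewrite j0.
have [M M0 hM] := periodic_bounded c0 p0.
pose B := M * (2 * pi).
have cB j : `|c j| <= B by exact: cos_coef_bound.
have p0' : 0 < p%:R :> R by rewrite ltr0n.
pose q : R := p%:R / p.+1%:R.
have q0 : 0 <= q by rewrite divr_ge0.
have q1 : q < 1 by rewrite ltr_pdivrMr// mul1r ltr_nat.
(* [q] bounds [p / j] for every [j > p]. The factor [2 B p] comes from comparing [B / j^(2m+2)] with
   [d p / j^2] when [d = |c p| / (2 p^(2m+2))]. *)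
have [m0 Hm0] : exists m0, forall m, (m0 <= m)%N -> 2 * B * p%:R * q ^+ m <= `|c p|.
  have /cvgrPdist_le : q ^+ n @[n --> \oo] --> (0 : R).
    by apply: cvg_expr; rewrite ger0_norm.
  have e0 : 0 < `|c p| / (2 * B * p%:R + 1).
    rewrite divr_gt0 ?normr_gt0// ltr_wpDl// !mulr_ge0//; exact: pi_ge0.
  move=> /(_ _ e0)[m0 _ Hm]; exists m0 => m /Hm/=.
  have D0 : 0 < 2 * B * p%:R + 1.
    by rewrite ltr_wpDl// !mulr_ge0//; exact: pi_ge0.
  rewrite sub0r normrN ger0_norm ?exprn_ge0// ler_pdivlMr// => H.
  apply: le_trans H; rewrite mulrDr mulr1 mulrC lerDl exprn_ge0//.
(* The parity of [m] is adjusted so that [(-1)^(m+1)] has the sign of [c p]. *)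
pose m := (m0.*2 + (0 < c p)%R)%N.
have mm0 : (m0 <= m.*2)%N by rewrite /m -!addnn -!addnA leq_addr.
have sgnc : (-1) ^+ m.+1 * c p = `|c p|.
  rewrite exprS exprD -mul2n exprM sqrrN expr1n expr1n mul1r.
  have [cp0|cp0] := ltP 0 (c p); first by rewrite expr1 mulN1r opprK mul1r gtr0_norm.
  by rewrite expr0 mulr1 mulN1r ler0_norm.
exists m; set g := h m.+1.*2.
have [cg pg zg] : zero_mean_periodic g by exact: zh.
have gE j : c j = (-1) ^+ m.+1 * j%:R ^+ m.+1.*2 * cos_coef j g.
  exact: cos_coef_iterated_primitive.
have gE' j : (0 < j)%N -> cos_coef j g = (-1) ^+ m.+1 * c j / j%:R ^+ m.+1.*2.
  have sgn2 : (-1) ^+ m.+1 * (-1) ^+ m.+1 = 1 :> R.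
    by rewrite -exprD addnn -signr_odd odd_double.
  move=> j0; rewrite gE !mulrA sgn2 mul1r.
  have n0 : j%:R ^+ m.+1.*2 != 0 :> R by rewrite expf_neq0// pnatr_eq0 -lt0n.
  by rewrite mulrAC mulfV// mul1r.
(* Half of the [p]-th cosine coefficient of [g]; the other half absorbs the tail. *)
pose d := `|c p| / p%:R ^+ m.+1.*2 / 2.
have d0 : 0 < d by rewrite !divr_gt0 ?normr_gt0 ?exprn_gt0.
have [S0 Sp] : (forall n, 0 <= \sum_(k < n) cos_coef k.+1 g) /\
  (forall n, (p <= n)%N -> d <= \sum_(k < n) cos_coef k.+1 g).
  apply: (@sum_inverse_squares_tail (fun j => cos_coef j g)) => //.
  - exact: ltW.
  - by move=> j /andP[j0 jp]; rewrite gE'// pmin ?j0// mulr0 mul0r.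
  - by rewrite gE'// sgnc /d mulrC divfK.
  - move=> j pj; have j0 : (0 < j)%N by exact: leq_trans pj.
    have j0' : 0 < j%:R :> R by rewrite ltr0n.
    rewrite gE'// !normrM normrX normrN1 expr1n mul1r normfV normrX [ `|j%:R|]ger0_norm//.
    have -> : d * p%:R / j%:R ^+ 2 = (d * p%:R * j%:R ^+ m.*2) / j%:R ^+ m.+1.*2.
      have frac (a x y : R) : x != 0 -> y != 0 -> a / y = a * x / (x * y).
        by move=> x0 y0; field; apply/andP.
      by rewrite doubleS -(addn2 m.*2) exprD -frac// expf_neq0// gt_eqF.
    apply: ler_wpM2r; first by rewrite invr_ge0 exprn_ge0.
    apply: (le_trans (cB j)).
    have qj : q * j%:R >= p%:R.
      rewrite /q mulrAC ler_pdivlMr// ler_wpM2l//  ?ler_nat//.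
    have := Hm0 _ mm0.
    have -> : d * p%:R * j%:R ^+ m.*2 = `|c p| * (j%:R ^+ m.*2 / p%:R ^+ m.*2) / (2 * p%:R).
      have frac (a x y z : R) : y != 0 -> z != 0 ->
        a / (y * z ^+ 2) / 2 * z * x = a * (x / y) / (2 * z) by move=> *; field; apply/andP.
      by rewrite /d doubleS -(addn2 m.*2) exprD frac// ?expf_neq0// gt_eqF.
    rewrite ler_pdivlMr ?mulr_gt0// => H.
    have J0 : 0 < j%:R ^+ m.*2 / p%:R ^+ m.*2 :> R by rewrite divr_gt0 ?exprn_gt0.
    apply: le_trans (ler_wpM2r (ltW J0) H).
    rewrite mulrCA mulrA -[leRHS]mulrA; apply: ler_peMr.
      by rewrite !mulr_ge0// pi_ge0.
    rewrite mulrA -exprMn ler_pdivlMr ?exprn_gt0// mul1r.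
    by apply: lerXn2r qj; rewrite nnegrE ?mulr_ge0.
have Sg n : cos_partial_sum g n = 2 * \sum_(k < n) cos_coef k.+1 g.
  by rewrite /cos_partial_sum cos_coef0 zg add0r.
have : 2 * d <= 2 * pi * g 0.
  apply: (@partial_sums_lower_bound _ _ p) => // n; rewrite Sg.
    by rewrite mulr_ge0.
  by move=> pn; rewrite ler_wpM2l// Sp.
by rewrite -mulrA ler_pM2l// => /(lt_le_trans d0); rewrite pmulr_rgt0// pi_gt0.
Qed.

End sign_of_iterated_primitives.

(** * The polynomial weight *)

Section weight.
Variable R : realType.
Implicit Types (f g h F : R -> R) (a b c x u : R) (P Q S : {poly R}).

Local Notation mu := (@lebesgue_measure R).

(** If the integral were zero, a primitive, being nondecreasing with equal values at the endpoints,
    would be constant, and its derivative at [c] would vanish. *)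
Lemma Rintegral_gt0_continuous f a b c : continuous f ->
  (forall x, x \in `[a, b] -> 0 <= f x) -> c \in `]a, b[ -> 0 < f c ->
  0 < \int[mu]_(t in `[a, b]) f t.
Proof.
move=> cf f0; rewrite in_itv/= => /andP[ac cb] fc.
have ab : a <= b by rewrite ltW// (lt_trans ac).
have [F dF] := continuous_primitive cf.
rewrite lt_def Rintegral_ge0 => [|x]; last exact: f0.
rewrite andbT; apply/eqP => int0.
have Fc x : x \in `]a, b[ -> cst (F a) x = F x.
  rewrite in_itv/= => /andP[ax xb].
  have ge0 y z : a <= y -> y <= z -> z <= b -> F y <= F z.
    move=> ay yz zb; rewrite -subr_ge0 -(Rintegral_is_derive yz cf dF).
    apply: Rintegral_ge0 => t /=; rewrite in_itv/= => /andP[yt tz].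
    by apply: f0; rewrite in_itv/= (le_trans ay)//= (le_trans tz).
  have FaFb : F b = F a by apply/eqP; rewrite -subr_eq0 -(Rintegral_is_derive ab cf dF) int0.
  by apply/le_anti/andP; split; [|rewrite /= -FaFb]; apply: ge0; rewrite ?lexx// ltW.
have d0 : is_derive c 1 F 0.
  apply: (@near_eq_is_derive _ _ _ (cst (F a))).
  near=> x; apply: Fc; near: x; apply: near_in_itvoo.
  by rewrite in_itv/= ac cb.
have := @derive_val _ _ _ _ _ _ _ d0; rewrite (@derive_val _ _ _ _ _ _ _ (dF c)).
by move=> fc0; rewrite fc0 ltxx in fc.
Unshelve. all: by end_near. Qed.

Section primitives.
Variable h : nat -> R -> R.
Hypothesis zh : forall n, zero_mean_periodic (h n).
Hypothesis dh : forall n x, is_derive x 1 (h n.+1) (h n x).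

Let ch n : continuous (h n). Proof. by case: (zh n). Qed.

Let continuous_hP n P u : continuous (fun s => h n (u * s) * P.[s]).
Proof.
by apply: continuous_mul; [exact: continuous_scale_arg | exact: continuous_horner].
Qed.

Lemma integration_by_parts_dilation n P u :
  u * \int[mu]_(s in `[0, 1]) (h n (u * s) * P.[s]) =
  h n.+1 u * P.[1] - h n.+1 0 * P.[0]
  - \int[mu]_(s in `[0, 1]) (h n.+1 (u * s) * P^`().[s]).
Proof.
have dH (s : R) : is_derive s 1 (fun s => h n.+1 (u * s) * P.[s])
    (u * (h n (u * s) * P.[s]) + h n.+1 (u * s) * P^`().[s]).
  have := is_derive_fun_mul (is_derive_scale_arg (dh n (u * s))) (is_derive_poly P s).
  by rewrite -mulrA.
have c1 : continuous (fun s => u * (h n (u * s) * P.[s])).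
  by apply: continuous_mul => //; exact: continuous_const.
have := Rintegral_is_derive ler01 (continuous_add c1 (@continuous_hP n.+1 P^`() u)) dH.
rewrite RintegralD_continuous// RintegralZ_continuous// mulr1 mulr0 => <-.
by rewrite addrK.
Qed.

Lemma dilation_integral_bounded n P : exists C, forall u,
  `|\int[mu]_(s in `[0, 1]) (h n (u * s) * P.[s])| <= C.
Proof.
have [_ pn _] := zh n; have [M M0 hM] := periodic_bounded (@ch n) pn.
have [c _ Pc] := EVT_max ler01 (continuous_subspaceT (continuous_normr (@continuous_horner R P))).
exists (M * `|P.[c]| * (1 - 0)) => u.
apply: Rintegral_le_cst => // s s01; rewrite normrM ler_pM//; exact: Pc.
Qed.

(** Each integration by parts replaces [P] by its derivative and lowers both orders of vanishing by
    one. The boundary terms at 1 all vanish; at 0 only the last survives, with [P^(n)(0) = n! Q(0)].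
    The index [k] is general because the induction moves it to [k.+1]. *)
Lemma dilation_integral_asymptotics n P Q S k :
  P = 'X^n * Q -> P = ('X - 1%:P) ^+ n.+1 * S ->
  exists C, forall u, u != 0 ->
    `|u ^+ n.+1 * \int[mu]_(s in `[0, 1]) (h k (u * s) * P.[s])
      - (-1) ^+ n.+1 * n`!%:R * Q.[0] * h (k + n.+1)%N 0| <= C / `|u|.
Proof.
elim: n P Q S k => [|n IH] P Q S k PQ PS.
  have [C HC] := dilation_integral_bounded k.+2 P^`()^`().
  have [_ p2 _] := zh k.+2.
  have [M M0 hM] := periodic_bounded (@ch k.+2) p2.
  exists (M * `|P^`().[1]| + M * `|P^`().[0]| + C) => u u0.
  rewrite expr1 integration_by_parts_dilation.
  have -> : P.[1] = 0 by rewrite PS hornerM expr1 hornerXsubC subrr mul0r.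
  rewrite mulr0 sub0r -[Q]mul1r -(expr0 'X) -PQ addn1 fact0 expr1.
  rewrite (_ : _ - _ = - \int[mu]_(s in `[0, 1]) (h k.+1 (u * s) * P^`().[s])); last by ring.
  (* One integration beyond the leading term: [u] times the remainder is a sum of bounded
     quantities, whence the rate [1 / |u|]. *)
  rewrite normrN ler_pdivlMr ?normr_gt0// mulrC -normrM integration_by_parts_dilation.
  apply: (le_trans (ler_normB _ _)); rewrite lerD ?HC//.
  by apply: (le_trans (ler_normB _ _)); rewrite !normrM lerD// ler_wpM2r.
have dPQ : P^`() = 'X^n * (n.+1%:R%:P * Q + 'X * Q^`()).
  by rewrite PQ derivM derivXn exprS -[X in X * Q]mulr_natl -polyC_natr; ring.
have dPS : P^`() = ('X - 1%:P) ^+ n.+1 * (n.+2%:R%:P * S + ('X - 1%:P) * S^`()).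
  by rewrite PS derivM deriv_exp derivXsubC mul1r polyC_natr -mulr_natl exprS -pred_Sn exprS; ring.
have [C HC] := IH _ _ _ k.+1 dPQ dPS.
exists C => u u0.
rewrite [u ^+ _]exprSr -mulrA integration_by_parts_dilation.
have -> : P.[1] = 0 by rewrite PS hornerM horner_exp hornerXsubC subrr expr0n mul0r.
have -> : P.[0] = 0 by rewrite PQ hornerM hornerXn expr0n mul0r.
have := HC _ u0; rewrite !hornerE/= !addnS addSn -normrN; congr (`|_| <= _).
by rewrite factS natrM !exprS; ring.
Qed.

End primitives.

(* The weight vanishes to odd order [n] at 0 and to higher order at 1, so the value
   of the dilated integral is governed by the iterated primitive [h n.+1] at 0. *)
Lemma dilation_integral_ge0 f : zero_mean_periodic f -> f 0 < 0 ->
  exists (gamma : R) P, [/\ 0 < gamma,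
    forall s, s \in `[0, 1] -> 0 <= P.[s],
    forall s, s != 0 -> s != 1 -> P.[s] != 0 &
    forall u, gamma <= `|u| -> 0 <= \int[mu]_(s in `[0, 1]) (f (u * s) * P.[s])].
Proof.
move=> zf f0; have [h [h0 zh dh]] := zero_mean_periodic_primitives zf.
have [m hm] : exists m, 0 < h m.+1.*2 0.
  by apply: iterated_primitive_gt0 => //; rewrite h0.
(* With [n] odd, [u^(n+1)] and [(s-1)^(n+1)] are nonnegative and the sign [(-1)^(n+1)]
   disappears. *)
pose n := m.*2.+1; have nE : n.+1 = m.+1.*2 by [].
pose P : {poly R} := 'X^n * ('X - 1%:P) ^+ n.+1.
have PE s : P.[s] = s ^+ n * (s - 1) ^+ n.+1.
  by rewrite hornerM hornerXn horner_exp hornerXsubC.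
have PS : P = ('X - 1%:P) ^+ n.+1 * 'X^n by rewrite mulrC.
have [C HC] := dilation_integral_asymptotics zh dh 0 erefl PS.
pose L := n`!%:R * h n.+1 0.
have L0 : 0 < L by rewrite mulr_gt0// ltr0n fact_gt0.
have ev (x : R) : 0 <= x ^+ n.+1 by rewrite nE exprn_even_ge0// odd_double.
(* Beyond [|C| / L] the error [C / |u|] cannot exceed the leading term [L]; the added 1 keeps the
   threshold positive. *)
exists (`|C| / L + 1), P; split.
- by rewrite ltr_wpDl// divr_ge0// ltW.
- move=> s; rewrite in_itv/= => /andP[s0 _]; rewrite PE.
  by rewrite mulr_ge0// exprn_ge0.
- by move=> s s0 s1; rewrite PE mulf_neq0// expf_neq0// subr_eq0.
move=> u gu; have u0 : 0 < `|u|.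
  by apply: lt_le_trans gu; rewrite ltr_wpDl// divr_ge0// ltW.
have un0 : u != 0 by rewrite -normr_gt0.
have := HC _ un0; rewrite h0 add0n ler_norml => /andP[+ _].
have sgn1 : (-1) ^+ n.+1 = 1 :> R by rewrite nE -signr_odd odd_double.
rewrite horner_exp hornerXsubC sub0r sgn1 mulr1 mul1r -/L => H.
have CL : C / `|u| <= L.
  rewrite ler_pdivrMr// (le_trans (ler_norm _))// mulrC -ler_pdivrMr//.
  by rewrite (le_trans _ gu)// lerDl.
have : 0 <= u ^+ n.+1 * \int[mu]_(s in `[0, 1]) (f (u * s) * P.[s]) by lra.
by rewrite pmulr_rge0// lt_def ev expf_neq0.
Qed.

(** A nowhere dense zero set is not the whole line, so [psi] is positive somewhere. The point can be
    moved into the open period, because [psi] vanishes at both endpoints. *)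
Lemma mean_gt0 (psi : R -> R) : in_Phi psi -> 0 < mean psi.
Proof.
move=> [cpsi psi0 ppsi nd z].
have p2 : 0 < 2 * pi :> R by rewrite mulr_gt0// pi_gt0.
rewrite /mean mulr_gt0 ?invr_gt0//.
have [t pt] : exists t, psi t != 0.
  apply: contrapT => /forallNP Z.
  have : nowhere_dense [set: R].
    move: nd; congr nowhere_dense; apply/seteqP; split => // x _ /=.
    by have /negP := Z x; rewrite negbK => /eqP.
  rewrite /nowhere_dense closureT interiorT => /seteqP[+ _] => /(_ 0 I).
  by [].
have [y y02 E] := periodic_segment ppsi t.
rewrite E in pt.
apply: (@Rintegral_gt0_continuous _ _ _ y) => //; last by rewrite lt_def pt psi0.
move: y02; rewrite !in_itv/= => /andP[y0 y2]; rewrite !lt_def y0 y2 !andbT.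
apply/andP; split; apply: contraNneq pt => Y; first by rewrite Y z.
by rewrite -Y -[2 * pi]add0r ppsi z.
Qed.

(** The weight is the polynomial divided by its integral; writing [psi] as its mean plus [f], the
    mean contributes itself and [f] a nonnegative amount. Continuity of [V], which [is_weight] does
    not contain, is recorded for the averaging argument. *)
Theorem exists_weight (psi : R -> R) : in_Phi psi ->
  exists gamma V, [/\ 0 < gamma, is_weight V, continuous V &
    forall u, gamma <= `|u| ->
      mean psi <= \int[mu]_(s in `[0, 1]) (psi (u * s) * V s)].
Proof.
move=> Hpsi; have m0 := mean_gt0 Hpsi; have [cpsi psi0 ppsi nd z] := Hpsi.
have p2 : 0 < 2 * pi :> R by rewrite mulr_gt0// pi_gt0.
pose f x := psi x - mean psi.
have cf : continuous f by apply: continuous_sub => //; exact: continuous_const.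
have zf : zero_mean_periodic f.
  split=> // [x|]; first by rewrite /f ppsi.
  rewrite RintegralB_continuous//; last exact: continuous_const.
  rewrite Rintegral_segment_cst ?(ltW p2)// subr0 /mean mulrAC mulVf ?gt_eqF//.
  by rewrite mul1r subrr.
have f0 : f 0 < 0 by rewrite /f z sub0r oppr_lt0.
have [gamma [P [g0 P0 Pn0 HP]]] := dilation_integral_ge0 zf f0.
have cP := @continuous_horner R P.
pose c := \int[mu]_(s in `[0, 1]) P.[s].
have half01 : (2^-1 : R) \in `]0, 1[.
  by rewrite in_itv/= invr_gt0 ltr0n invf_lt1// ltr1n.
have c0 : 0 < c.
  apply: (@Rintegral_gt0_continuous _ _ _ 2^-1) => //.
  rewrite lt_def Pn0 ?P0 ?invr_eq0 ?pnatr_eq0//.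
    by apply: subset_itv_oo_cc half01.
  by rewrite invr_eq1 (eqr_nat R 2 1).
pose V s := c^-1 * P.[s].
have cV : continuous V by apply: continuous_mul => //; exact: continuous_const.
have V1 : \int[mu]_(s in `[0, 1]) V s = 1.
  by rewrite RintegralZ_continuous// mulVf ?gt_eqF.
exists gamma, V; split => //.
  split => //.
  - by move=> t t01; rewrite mulr_ge0 ?invr_ge0 ?(ltW c0)// P0.
  - exact: continuous_integrable.
  - change (mu.-negligible (~` [set t | t \in `[0, 1] -> V t != 0])).
    have N : mu.-negligible ([set 0; 1] : set R).
      by apply: negligibleU; apply/negligibleP => //; exact: lebesgue_measure_set1.
    apply: negligibleS N => t /=.
    apply: contra_notP => /not_orP[/eqP t0 /eqP t1] _.
    by apply: mulf_neq0; [rewrite invr_eq0 gt_eqF | exact: Pn0].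
move=> u gu.
have cfu : continuous (fun s => f (u * s)) by exact: continuous_scale_arg.
have E : \int[mu]_(s in `[0, 1]) (psi (u * s) * V s) =
    \int[mu]_(s in `[0, 1]) (c^-1 * (f (u * s) * P.[s]) + mean psi * V s).
  by apply: eq_Rintegral => s _; rewrite /f /V; ring.
rewrite E RintegralD_continuous; last 2 first.
- by apply: continuous_mul; [exact: continuous_const|exact: continuous_mul].
- by apply: continuous_mul => //; exact: continuous_const.
rewrite [X in X + _]RintegralZ_continuous; last exact: continuous_mul.
rewrite [X in _ + X]RintegralZ_continuous// V1 mulr1 lerDr mulr_ge0 ?invr_ge0 ?(ltW c0)//; exact: HP.
Qed.

End weight.

(** * Orthogonality of spectral projections and the spectral measure of a vector *)

Section resolution_of_identity.
Variables (R : realType) (H : completeNormedModType R[i]).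
Variables (dot : {dot H for conjC}) (Hdot : is_hilbert dot).
Implicit Types (x y z : H) (A B : set R).

Definition nsq x : R := hnorm x ^+ 2.

Lemma hnormE x : (hnorm x)%:C%C = `|x|.
Proof. by rewrite /hnorm RRe_real// normr_real. Qed.

Lemma hnorm_ge0 x : 0 <= hnorm x.
Proof. by rewrite -ler0c hnormE. Qed.

Lemma nsq_ge0 x : 0 <= nsq x. Proof. exact: sqr_ge0. Qed.

Lemma nsqE x : (nsq x)%:C%C = dot x x.
Proof. by rewrite -Hdot -hnormE -rmorphXn. Qed.

Lemma hnorm_sqrt x : hnorm x = Num.sqrt (nsq x).
Proof. by rewrite sqrtr_sqr ger0_norm// hnorm_ge0. Qed.

Lemma hnorm0 : hnorm (0 : H) = 0.
Proof. by apply: complexI; rewrite hnormE normr0. Qed.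

Lemma nsq0 : nsq 0 = 0. Proof. by rewrite /nsq hnorm0 expr0n. Qed.

Lemma nsq_eq0 x : nsq x = 0 -> x = 0.
Proof.
move=> /eqP; rewrite sqrf_eq0 => /eqP n0; apply/eqP.
by rewrite -normr_eq0 -hnormE n0.
Qed.

Lemma nsqD x y : dot x y = 0 -> nsq (x + y) = nsq x + nsq y.
Proof. by move=> xy; apply: complexI; rewrite rmorphD/= !nsqE hnormDd. Qed.

Lemma nsqZ (a : R[i]) x : nsq (a *: x) = complex.Re `|a| ^+ 2 * nsq x.
Proof.
apply: complexI; rewrite [LHS]nsqE dnormZ -nsqE -{1}(RRe_real (normr_real a)).
by rewrite -rmorphXn -rmorphM.
Qed.

Lemma nsq_sum (T : eqType) (r : seq T) (v : T -> H) : uniq r ->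
  (forall i j, i != j -> dot (v i) (v j) = 0) ->
  nsq (\sum_(i <- r) v i) = \sum_(i <- r) nsq (v i).
Proof.
move=> + vo; elim: r => [|i r IH] /=; first by rewrite !big_nil nsq0.
move=> /andP[ir ur]; rewrite !big_cons nsqD ?IH//.
rewrite linear_sumr/= big_seq big1// => j jr; apply: vo.
by apply: contraNneq ir => ->.
Qed.

Variables (E : set R -> {linear H -> H}) (HE : resolution_of_identity dot E).

Lemma proj_idem A x : measurable A -> E A (E A x) = E A x.
Proof. by case: HE => HP _ _ _ /HP[]. Qed.

Lemma proj_sym A x y : measurable A -> dot (E A x) y = dot x (E A y).
Proof. by case: HE => HP _ _ _ /HP[]. Qed.

Lemma proj_set0 x : E set0 x = 0. Proof. by case: HE. Qed.

Lemma proj_setT x : E setT x = x. Proof. by case: HE. Qed.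

Lemma proj_setU A B x : measurable A -> measurable B -> A `&` B = set0 ->
  E (A `|` B) x = E A x + E B x.
Proof.
move=> mA mB AB; case: HE => _ _ _ /(_ (bigcup2 A B)).
have mF n : measurable (bigcup2 A B n) by case: n => [|[|n]] //=; exact: measurable0.
have tF : trivIset setT (bigcup2 A B) by rewrite -trivIset_bigcup2.
move=> /(_ mF tF x); rewrite bigcup2E => c1.
have c2 : (fun n => \sum_(k < n) E (bigcup2 A B k) x) @ \oo --> E A x + E B x.
  apply: cvg_near_cst; exists 2%N => // -[|[|n]]// _ /=.
  rewrite big_ord_recl big_ord_recl/= big1 ?addr0// => i _.
  exact: proj_set0.
exact: (cvg_unique _ c1 c2).
Qed.

(* Two projections whose sum is idempotent are orthogonal: PQ + QP = 0 forces
   PQ = - PQP = QP. *)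
Lemma proj_disjoint A B x : measurable A -> measurable B -> A `&` B = set0 ->
  E A (E B x) = 0.
Proof.
move=> mA mB AB; pose P := E A; pose Q := E B.
have cancel (a b c d : H) : (a + b) + (c + d) = a + d -> b + c = 0.
  by move=> abcd; apply: (addrI (a + d)); rewrite addr0 addrACA [d + c]addrC.
have anti y : P (Q y) + Q (P y) = 0.
  apply: (cancel (P y) _ _ (Q y)).
  have := @proj_idem (A `|` B) y (measurableU _ _ mA mB).
  by rewrite !proj_setU// !linearD/= !proj_idem.
have PQP y : P (Q y) + P (Q (P y)) = 0.
  by have := congr1 P (anti y); rewrite linearD linear0/= [P (P _)]proj_idem.
have QPQ : P (Q (P x)) + Q (P x) = 0.
  by have := anti (P x); rewrite [P (P _)]proj_idem.
have PQE : P (Q x) = Q (P x).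
  by apply: (addrI (P (Q (P x)))); rewrite QPQ addrC PQP.
have : 2%:R *: P (Q x) = 0 by rewrite scaler_nat mulr2n {2}PQE anti.
by move=> /eqP; rewrite scaler_eq0 pnatr_eq0/= => /eqP.
Qed.

Lemma dot_proj_disjoint A B x y : measurable A -> measurable B ->
  A `&` B = set0 -> dot (E A x) (E B y) = 0.
Proof. by move=> mA mB AB; rewrite proj_sym// proj_disjoint// linear0r. Qed.

Lemma proj_bigsetU (T : eqType) (r : seq T) (F : T -> set R) x : uniq r ->
  (forall i, measurable (F i)) -> (forall i j, i != j -> F i `&` F j = set0) ->
  E (\big[setU/set0]_(i <- r) F i) x = \sum_(i <- r) E (F i) x.
Proof.
move=> + mF dF; elim: r => [|i r IH] /=; first by rewrite !big_nil proj_set0.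
move=> /andP[ir ur]; rewrite !big_cons proj_setU ?IH//.
  exact: bigsetU_measurable.
rewrite big_distrr/= big_seq big1// => j jr; apply: dF.
by apply: contraNneq ir => ->.
Qed.

Lemma hnormD_le x y : hnorm (x + y) <= hnorm x + hnorm y.
Proof. by rewrite -lecR rmorphD/= !hnormE ler_normD. Qed.

Lemma hnormN x : hnorm (- x) = hnorm x.
Proof. by rewrite /hnorm normrN. Qed.

Lemma dist_hnorm_le x y : `|hnorm x - hnorm y| <= hnorm (x - y).
Proof.
have le z t : hnorm z - hnorm t <= hnorm (z - t).
  by rewrite lerBlDr -{1}[z](subrK t) hnormD_le.
by rewrite ler_norml le andbT lerNl opprB -[x - y]opprB hnormN le.
Qed.

Lemma hnorm_cvg (u : nat -> H) y : u n @[n --> \oo] --> y ->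
  hnorm (u n) @[n --> \oo] --> hnorm y.
Proof.
move=> uy; apply/cvgrPdist_le => e e0.
have e0' : 0 < e%:C%C by rewrite ltcR.
have /cvgrPdist_le/(_ _ e0') := uy.
apply: filterS => n; rewrite -hnormE lecR; apply: le_trans.
exact: dist_hnorm_le.
Qed.

Lemma nsq_cvg (u : nat -> H) y : u n @[n --> \oo] --> y ->
  nsq (u n) @[n --> \oo] --> nsq y.
Proof. by move=> /hnorm_cvg uy; exact: (cvgM uy uy). Qed.

(** Projections of disjoint sets have orthogonal ranges, so by Pythagoras the squared norm of a
    partial sum is the sum of the masses; continuity of the norm turns strong additivity of [E] into
    additivity of [m]. *)
Lemma spectral_measure_exists x : exists m : {finite_measure set R -> \bar R},
  forall A, m A = (nsq (E A x))%:E.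
Proof.
pose m A : \bar R := (nsq (E A x))%:E.
have m0 : m set0 = 0%E by rewrite /m proj_set0 nsq0.
have m_ge0 A : (0 <= m A)%E by rewrite lee_fin nsq_ge0.
have m_sigma : semi_sigma_additive m.
  move=> F mF tF mU.
  case: HE => _ _ _ /(_ F mF tF x) /nsq_cvg cF.
  have -> : (fun n => (\sum_(0 <= i < n) m (F i))%E) =
      (fun n => (nsq (\sum_(k < n) E (F k) x))%:E).
    apply/funext => n; rewrite nsq_sum ?index_enum_uniq//.
      by rewrite big_mkord sumEFin.
    move=> i j ij; apply: dot_proj_disjoint => //.
    by move/trivIsetP: tF => /(_ i j I I); apply.
  by apply: cvg_EFin; [exact: nearW | exact: cF].
have m_fin : fin_num_fun m by [].
pose M1 := isMeasure.Build _ _ _ m m0 m_ge0 m_sigma.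
pose M2 : Measure.type _ _ := HB.pack m M1.
have M2fin : fin_num_fun M2 by [].
pose M3 := Measure_isFinite.Build _ _ _ M2 M2fin.
pose M4 : FiniteMeasure.type _ _ := HB.pack (Measure.sort M2) M3.
by exists M4.
Qed.

End resolution_of_identity.

(** * Spectral integrals of simple functions *)

Section simple_spectral_integrals.
Variables (R : realType) (H : completeNormedModType R[i]).
Variables (dot : {dot H for conjC}) (Hdot : is_hilbert dot).
Variables (E : set R -> {linear H -> H}) (HE : resolution_of_identity dot E).
Implicit Types (x y z : H) (A B : set R) (f s : R -> R[i]).

Lemma proj_partition (T : choiceType) (r : seq T) (p : R -> T) A x :
  uniq r -> (forall t, p t \in r) -> (forall i, measurable (p @^-1` [set i])) ->
  measurable A -> E A x = \sum_(i <- r) E (A `&` p @^-1` [set i]) x.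
Proof.
move=> ur pr mp mA; rewrite -(proj_bigsetU HE)//.
- congr (E _ x); rewrite -bigcup_seq; apply/seteqP; split => t /=.
    by move=> At; exists (p t) => //=; exact: pr.
  by move=> [i _ []].
- by move=> i; exact: measurableI.
- move=> i j ij; apply/seteqP; split => t //= -[[_ pi] [_ pj]].
  by move: ij; rewrite -pi -pj eqxx.
Qed.

(** The integral may be computed on any finite measurable partition, labelled by [p], on whose cells
    [s] is constant. This allows two simple functions to be compared on a common refinement. *)
Lemma simple_spectral_int_factor (T : choiceType) (r : seq T) (p : R -> T)
    (c : T -> R[i]) s x :
  uniq r -> (forall t, p t \in r) -> (forall i, measurable (p @^-1` [set i])) ->
  (forall t, s t = c (p t)) -> borel_simple s ->
  simple_spectral_int E s x = \sum_(i <- r) c i *: E (p @^-1` [set i]) x.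
Proof.
move=> ur pr mp sE [fs ms]; rewrite /simple_spectral_int fsbig_finite//=.
transitivity (\sum_(a <- fset_set (range s)) \sum_(i <- r)
    (if c i == a then c i *: E (p @^-1` [set i]) x else 0)).
  apply: eq_bigr => a _; rewrite (proj_partition x ur pr mp (ms a)) scaler_sumr.
  apply: eq_bigr => i _; case: eqVneq => [<-|ca].
    congr (_ *: E _ x); apply/seteqP; split=> t /=; first by case.
    by move=> pt; split => //; rewrite sE pt.
  rewrite (_ : _ `&` _ = set0) ?(proj_set0 HE) ?scaler0//.
  apply/seteqP; split => t //= -[st pt].
  by move: ca; rewrite -pt -sE st eqxx.
rewrite exchange_big/=; apply: eq_bigr => i _.
have [/= ri|ri] := boolP (c i \in fset_set (range s)).
  rewrite (bigD1_seq (c i))//= ?fset_uniq// eqxx big1 ?addr0// => a.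
  by rewrite eq_sym => /negbTE ->.
rewrite big_seq big1 => [|a ra]; last first.
  by case: eqVneq => // ca; rewrite ca ra in ri.
(* A label whose value [s] never takes has an empty cell. *)
rewrite (_ : p @^-1` [set i] = set0) ?(proj_set0 HE) ?scaler0//.
apply/seteqP; split => t //= pt.
move: ri; rewrite in_fset_set// => /negP; apply; rewrite inE/=.
by exists t => //; rewrite sE pt.
Qed.

Lemma nsq_combination (T : choiceType) (r : seq T) (p : R -> T) (c : T -> R[i]) x :
  uniq r -> (forall i, measurable (p @^-1` [set i])) ->
  nsq (\sum_(i <- r) c i *: E (p @^-1` [set i]) x) =
  \sum_(i <- r) complex.Re `|c i| ^+ 2 * nsq (E (p @^-1` [set i]) x).
Proof.
move=> ur mp; rewrite (nsq_sum Hdot)//.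
  by apply: eq_bigr => i _; rewrite (nsqZ Hdot).
move=> i j ij; rewrite linearZl_LR/= linearZr_LR/= (dot_proj_disjoint HE) ?mulr0//.
apply/seteqP; split => t //= -[pi pj].
by move: ij; rewrite -pi -pj eqxx.
Qed.

Lemma borel_simple_enum s : borel_simple s ->
  [/\ uniq (fset_set (range s)), forall t, s t \in (fset_set (range s) : seq _) &
      forall c, measurable (s @^-1` [set c])].
Proof.
by move=> [fs ms]; split => // t; rewrite in_fset_set// inE; exists t.
Qed.

Lemma nsq_simple_spectral_int s x : borel_simple s ->
  nsq (simple_spectral_int E s x) =
  \sum_(c <- fset_set (range s)) complex.Re `|c| ^+ 2 * nsq (E (s @^-1` [set c]) x).
Proof.
move=> bs; have [us ss ms] := borel_simple_enum bs.
by rewrite (@simple_spectral_int_factor _ (fset_set (range s)) s id)// nsq_combination.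
Qed.

(** On the partition by the pair [(s1, s2)] the difference is a combination of orthogonal vectors
    with sum [x] and coefficients bounded by [e]. *)
Lemma simple_spectral_int_dist s1 s2 (e : R) x :
  borel_simple s1 -> borel_simple s2 -> 0 <= e ->
  (forall t, `|s1 t - s2 t| <= e%:C%C) ->
  hnorm (simple_spectral_int E s1 x - simple_spectral_int E s2 x) <= e * hnorm x.
Proof.
move=> b1 b2 e0 s12.
have [[f1 m1] [f2 m2]] := (b1, b2).
pose p t := (s1 t, s2 t).
have fp : finite_set (range p).
  apply: (@sub_finite_set _ _ (range s1 `*` range s2)); last exact: finite_setX.
  by move=> _ [t _ <-]; split; exists t.
have mp i : measurable (p @^-1` [set i]).
  rewrite (_ : _ @^-1` _ = s1 @^-1` [set i.1] `&` s2 @^-1` [set i.2]).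
    exact: measurableI.
  case: i => a b; apply/seteqP; split => t /=; first by move=> [<- <-].
  by rewrite /p => -[-> ->].
pose r : seq _ := fset_set (range p).
have ur : uniq r by exact: fset_uniq.
have pr t : p t \in r by rewrite in_fset_set// inE; exists t.
rewrite (@simple_spectral_int_factor _ r p fst s1)//.
rewrite (@simple_spectral_int_factor _ r p snd s2)//.
rewrite -sumrB; under eq_bigr do rewrite -scalerBl.
rewrite -(@ler_pXn2r _ 2)// ?nnegrE ?mulr_ge0 ?hnorm_ge0// exprMn.
rewrite -/(nsq _) -/(nsq x) nsq_combination//.
apply: (@le_trans _ _ (\sum_(i <- r) e ^+ 2 * nsq (E (p @^-1` [set i]) x))).
  rewrite big_seq [leRHS]big_seq; apply: ler_sum => i.
  rewrite in_fset_set// inE => -[t _ <-].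
  rewrite ler_wpM2r ?nsq_ge0// lerXn2r ?nnegrE//; last first.
    by rewrite -lecR RRe_real ?normr_real//; exact: s12.
  by rewrite -ler0c RRe_real ?normr_real.
have -> : nsq x = \sum_(i <- r) nsq (E (p @^-1` [set i]) x).
  have xE := proj_partition x ur pr mp (@measurableT _ R).
  rewrite -[in LHS](proj_setT HE x) xE.
  have := nsq_combination (fun=> 1) x ur mp.
  under eq_bigr do rewrite scale1r.
  under [in RHS]eq_bigr do rewrite normr1 expr1n mul1r.
  by move=> <-; congr nsq; apply: eq_bigr => i _; rewrite setTI.
by rewrite mulr_sumr.
Qed.

End simple_spectral_integrals.

(** * Existence of spectral integrals of bounded Borel functions *)

Section spectral_integrals.
Variables (R : realType) (H : completeNormedModType R[i]).
Variables (dot : {dot H for conjC}) (Hdot : is_hilbert dot).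
Variables (E : set R -> {linear H -> H}) (HE : resolution_of_identity dot E).
Implicit Types (x y z : H) (A B : set R) (f s : R -> R[i]) (h : R -> R).

Lemma measurable_floor_fiber h (k : int) : measurable_fun setT h ->
  measurable ((fun t => Num.floor (h t)) @^-1` [set k]).
Proof.
move=> mh; rewrite (_ : _ @^-1` _ = h @^-1` `[k%:~R, (k + 1)%:~R[%classic).
  by rewrite -[X in measurable X]setTI; exact: mh.
apply/seteqP; split => t /=; rewrite in_itv/=.
  by move=> <-; exact: floor_itv.
by move=> /floor_def.
Qed.

Definition quantize (n : nat) (u : R) : R := (Num.floor (n.+1%:R * u))%:~R / n.+1%:R.

Lemma quantize_dist n u : `|quantize n u - u| <= n.+1%:R^-1.
Proof.
have n0 : 0 < n.+1%:R :> R by rewrite ltr0n.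
have /andP[h1 h2] := floor_itv (n.+1%:R * u).
rewrite intrD in h2.
rewrite -[X in _ - X](mulfK (_ : n.+1%:R != 0)) ?gt_eqF// -mulrBl [u * _]mulrC.
rewrite normrM [X in _ * X]ger0_norm ?invr_ge0 ?(ltW n0)// ler_piMl ?invr_ge0 ?(ltW n0)//.
by rewrite ler_norml; apply/andP; split; lra.
Qed.

Lemma measurable_quantize_fiber h n (b : R) : measurable_fun setT h ->
  measurable ((fun t => quantize n (h t)) @^-1` [set b]).
Proof.
move=> mh; have n0 : n.+1%:R != 0 :> R by rewrite pnatr_eq0.
pose k := Num.floor (n.+1%:R * b).
have mk : measurable ((fun t => Num.floor (n.+1%:R * h t)) @^-1` [set k]).
  by apply: measurable_floor_fiber; exact: measurable_funM (measurable_cst _) mh.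
have [kb|kb] := eqVneq (k%:~R / n.+1%:R) b.
  rewrite (_ : _ @^-1` _ = (fun t => Num.floor (n.+1%:R * h t)) @^-1` [set k])//.
  apply/seteqP; split => t /=; rewrite /quantize; last by move=> ->.
  by rewrite /k => <-; rewrite [RHS](congr1 Num.floor (mulrC _ _)) divfK// intrKfloor.
rewrite (_ : _ @^-1` _ = set0)//; apply/seteqP; split => t //=.
rewrite /quantize => qb; case/eqP: kb; rewrite /k -qb.
by rewrite [n.+1%:R * _]mulrC divfK// intrKfloor.
Qed.

Lemma finite_quantize_range h n (M : R) : (forall t, `|h t| <= M) ->
  finite_set (range (fun t => quantize n (h t))).
Proof.
move=> hM; pose K := (Num.truncn (n.+1%:R * M)).+2.
apply: (@sub_finite_set _ _ ((fun i : nat => (i%:Z - K%:Z)%:~R / n.+1%:R) @` `I_K.*2)).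
  move=> _ [t _ <-] /=; rewrite /quantize.
  set k := Num.floor _.
  have /andP[k1 k2] : (- K%:Z <= k) && (k < K%:Z).
    have /andP[h1 h2] := floor_itv (n.+1%:R * h t); rewrite -/k in h1 h2.
    have KM : n.+1%:R * `|h t| < K%:R - 1.
      rewrite /K -(natr1 (Num.truncn _).+1) addrK; apply: le_lt_trans (truncnS_gt _).
      by rewrite ler_wpM2l.
    have : `|n.+1%:R * h t| < K%:R - 1 by rewrite normrM ger0_norm.
    rewrite ltr_norml => /andP[h3 h4].
    rewrite intrD in h2.
    by apply/andP; split; rewrite -1?(ler_int R) -1?(ltr_int R) ?rmorphN/=; lra.
  exists (absz (k + K%:Z)%R); last by rewrite gez0_abs ?addrK// -lerBlDr sub0r.
  rewrite -ltz_nat gez0_abs; last by rewrite -lerBlDr sub0r.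
  by rewrite -addnn PoszD ltrD2r.
exact/finite_image/finite_II.
Qed.

Definition quantizeC n f (t : R) : R[i] :=
  (quantize n (complex.Re (f t)) +i* quantize n (complex.Im (f t)))%C.

Definition bounded_borel f := [/\ measurable_fun setT (fun t => complex.Re (f t)),
  measurable_fun setT (fun t => complex.Im (f t)) &
  exists M : R, forall t, complex.Re `|f t| <= M].

Lemma Re_normc_ge (z : R[i]) :
  `|complex.Re z| <= complex.Re `|z| /\ `|complex.Im z| <= complex.Re `|z|.
Proof.
rewrite normc_def/=; split; rewrite -sqrtr_sqr ler_wsqrtr//.
  by rewrite lerDl sqr_ge0.
by rewrite lerDr sqr_ge0.
Qed.

Lemma normc_le_parts (z : R[i]) (a b : R) :
  `|complex.Re z| <= a -> `|complex.Im z| <= b -> `|z| <= (a + b)%:C%C.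
Proof.
move=> za zb; have a0 := le_trans (normr_ge0 _) za.
have b0 := le_trans (normr_ge0 _) zb.
rewrite normc_def lecR -[leRHS]ger0_norm ?addr_ge0// -sqrtr_sqr ler_wsqrtr//.
rewrite -[complex.Re z ^+ 2]real_normK ?num_real// -[complex.Im z ^+ 2]real_normK ?num_real//.
apply: (@le_trans _ _ (a ^+ 2 + b ^+ 2)).
  by rewrite lerD// lerXn2r ?nnegrE.
by rewrite sqrrD lerD2r lerDl mulrn_wge0// mulr_ge0.
Qed.

Lemma borel_simple_quantizeC n f : bounded_borel f -> borel_simple (quantizeC n f).
Proof.
move=> [mr mi [M fM]].
have fr := @finite_quantize_range (fun t => complex.Re (f t)) n M
  (fun t => le_trans (Re_normc_ge (f t)).1 (fM t)).
have fi := @finite_quantize_range (fun t => complex.Im (f t)) n M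
  (fun t => le_trans (Re_normc_ge (f t)).2 (fM t)).
split.
  pose X := range (fun t => quantize n (complex.Re (f t))).
  pose Y := range (fun t => quantize n (complex.Im (f t))).
  apply: (@sub_finite_set _ _ ((fun z : R * R => (z.1 +i* z.2)%C : R[i]) @` (X `*` Y))).
    move=> _ [t _ <-]; exists (quantize n (complex.Re (f t)), quantize n (complex.Im (f t))) => //.
    by split; exists t.
  by apply/finite_image/finite_setX.
move=> [a b].
rewrite (_ : _ @^-1` _ = ((fun t => quantize n (complex.Re (f t))) @^-1` [set a])
  `&` ((fun t => quantize n (complex.Im (f t))) @^-1` [set b])).
  by apply: measurableI; exact: measurable_quantize_fiber.
by apply/seteqP; split => t /=; rewrite /quantizeC => -[-> ->].
Qed.

Lemma quantizeC_dist n f t : `|quantizeC n f t - f t| <= (2 / n.+1%:R)%:C%C.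
Proof.
have -> : 2 / n.+1%:R = n.+1%:R^-1 + n.+1%:R^-1 :> R by rewrite mulr_natl mulr2n.
rewrite /quantizeC; case: (f t) => a b.
by apply: normc_le_parts; exact: quantize_dist.
Qed.

Lemma two_div_cvg0 (e : R) : 0 < e -> \forall n \near \oo, 2 / n.+1%:R <= e.
Proof.
move=> e0; exists (Num.truncn (2 / e)) => // n /= len.
rewrite ler_pdivrMr// mulrC -ler_pdivrMr//.
by apply/ltW/(lt_le_trans (truncnS_gt _)); rewrite ler_nat ltnS.
Qed.

(** The quantisations of [f] converge uniformly, so their integrals form a Cauchy sequence and
    completeness of [H] provides the limit. *)
Lemma is_spectral_int_exists f x : bounded_borel f -> exists y, is_spectral_int E f x y.
Proof.
move=> bf; pose S n := simple_spectral_int E (quantizeC n f) x.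
suff /cvg_ex[y Sy] : cvg (S n @[n --> \oo]).
  exists y, (fun n => quantizeC n f); split => //.
    by move=> n; exact: borel_simple_quantizeC.
  move=> e /two_div_cvg0; apply: filterS => n ne t.
  by apply: le_trans (quantizeC_dist _ _ _) _; rewrite lecR.
apply: cauchy_cvg; apply: cauchy_exP => e; case: e => e e' /[dup] e0.
rewrite ltcE/= => /andP[/eqP -> {}e0]; rewrite complexr0.
pose d := e / (2 * (hnorm x + 1)).
have x1 : 0 < hnorm x + 1 by rewrite ltr_wpDl ?hnorm_ge0.
have d0 : 0 < d by rewrite divr_gt0// mulr_gt0.
have [N _ HN] := two_div_cvg0 d0.
exists (S N); exists N => // n /= Nn.
rewrite -ball_normE/= -hnormE ltcR.
have le2 t : `|quantizeC N f t - quantizeC n f t| <= (d + d)%:C%C.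
  rewrite -[_ - _](subrKA (f t)) (le_trans (ler_normD _ _))// rmorphD lerD//.
    by apply: le_trans (quantizeC_dist _ _ _) _; rewrite lecR; apply: HN => /=.
  rewrite -normrN opprB.
  by apply: le_trans (quantizeC_dist _ _ _) _; rewrite lecR; exact: HN.
apply: le_lt_trans (simple_spectral_int_dist Hdot HE x _ _ _ le2) _.
- exact: borel_simple_quantizeC.
- exact: borel_simple_quantizeC.
- by rewrite addr_ge0// ltW.
rewrite (_ : d + d = e / (hnorm x + 1)); last first.
  by rewrite /d; field; rewrite gt_eqF.
by rewrite mulrAC ltr_pdivrMr// ltr_pM2l// ltrDl.
Qed.

End spectral_integrals.

(** * Bounded integrands and the isometry for spectral integrals *)

Lemma bounded_measurable_integrable_on (R : realType) (d : measure_display)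
    (T : measurableType d) (m : {measure set T -> \bar R}) (D : set T)
    (f : T -> R) (M : R) : measurable D -> (m D < +oo)%E -> measurable_fun D f ->
  (forall t, D t -> `|f t| <= M) -> m.-integrable D (EFin \o f).
Proof.
move=> mD Dfin mf fM; apply: measurable_bounded_integrable => //.
exists M; split; first exact: num_real.
by move=> N MN t Dt; exact: le_trans (fM t Dt) (ltW MN).
Qed.

Lemma bounded_measurable_integrable (R : realType) (d : measure_display)
    (T : measurableType d) (m : {finite_measure set T -> \bar R}) (D : set T)
    (f : T -> R) (M : R) : measurable D -> measurable_fun D f ->
  (forall t, D t -> `|f t| <= M) -> m.-integrable D (EFin \o f).
Proof.
move=> mD; apply: bounded_measurable_integrable_on => //.
by rewrite ltey_eq fin_num_measure.
Qed.

Section norm_of_spectral_integrals.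
Variables (R : realType) (H : completeNormedModType R[i]).
Variables (dot : {dot H for conjC}) (Hdot : is_hilbert dot).
Variables (E : set R -> {linear H -> H}) (HE : resolution_of_identity dot E).
Variables (x : H) (m : {finite_measure set R -> \bar R}).
Hypothesis mE : forall A, m A = (nsq (E A x))%:E.
Implicit Types (y : H) (A D : set R) (f s : R -> R[i]).

Let sqnorm f (t : R) : R := complex.Re `|f t| ^+ 2.

Lemma Re_norm_ge0 (z : R[i]) : 0 <= complex.Re `|z|.
Proof. by rewrite -ler0c RRe_real ?normr_real. Qed.

Lemma Re_norm_leD (z w : R[i]) (d : R) :
  `|z - w| <= d%:C%C -> complex.Re `|z| <= complex.Re `|w| + d.
Proof.
move=> zw; have : `|z| <= `|w| + d%:C%C.
  by rewrite -lerBlDl; apply: le_trans zw; exact: lerB_dist.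
by rewrite lecE => /andP[_]; case: (`|w|).
Qed.

Lemma simple_sqnormE s : borel_simple s -> forall t,
  sqnorm s t = \sum_(c <- fset_set (range s))
    complex.Re `|c| ^+ 2 * \1_(s @^-1` [set c]) t.
Proof.
move=> /borel_simple_enum[us ss _] t; rewrite (bigD1_seq (s t))//= indicE mem_set//= mulr1.
rewrite big1 ?addr0// => c cs; rewrite indicE memNset ?mulr0//=.
by move=> sc; rewrite sc eqxx in cs.
Qed.

Lemma measurable_simple_sqnorm s : borel_simple s -> measurable_fun setT (sqnorm s).
Proof.
move=> bs; have [_ _ ms] := borel_simple_enum bs.
rewrite (_ : sqnorm s = (fun t => \sum_(c <- fset_set (range s))
    complex.Re `|c| ^+ 2 * \1_(s @^-1` [set c]) t)).
  apply: measurable_sum => c.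
  by apply: measurable_funM; [exact: measurable_cst | exact: measurable_indic].
by apply/funext => t; exact: simple_sqnormE.
Qed.

Lemma nsq_simple_spectral_int_integral s : borel_simple s ->
  nsq (simple_spectral_int E s x) = \int[m]_t sqnorm s t.
Proof.
move=> bs; have [_ _ ms] := borel_simple_enum bs.
rewrite (nsq_simple_spectral_int Hdot HE)// /Rintegral.
under eq_integral do rewrite simple_sqnormE// -sumEFin.
rewrite ge0_integral_sum//.
- rewrite (eq_bigr (fun c =>
    (complex.Re `|c| ^+ 2 * nsq (E (s @^-1` [set c]) x))%:E)); first by rewrite sumEFin.
  move=> c _; under eq_integral do rewrite EFinM.
  rewrite ge0_integralZl//.
  + by rewrite integral_indic// setIT [RHS]EFinM; congr (_ * _)%E; exact: mE.
  + by apply/measurable_EFinP; exact: measurable_indic.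
  + by rewrite lee_fin sqr_ge0.
- move=> c; apply/measurable_EFinP.
  by apply: measurable_funM; [exact: measurable_cst | exact: measurable_indic].
- by move=> c t _; rewrite lee_fin mulr_ge0// sqr_ge0.
Qed.

Lemma measurable_sqnorm f : bounded_borel f -> measurable_fun setT (sqnorm f).
Proof.
move=> [mr mi _].
rewrite (_ : sqnorm f = fun t => complex.Re (f t) ^+ 2 + complex.Im (f t) ^+ 2).
  by apply: measurable_funD; exact: measurable_funX.
apply/funext => t; rewrite /sqnorm normc_def/= sqr_sqrtr//.
by rewrite addr_ge0 ?sqr_ge0.
Qed.

(** The identity for simple functions passes to the limit: on the left by continuity of the norm, on
    the right because the squared moduli converge uniformly and [m] is finite. *)
Lemma nsq_spectral_int f y : bounded_borel f -> is_spectral_int E f x y ->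
  nsq y = \int[m]_t sqnorm f t.
Proof.
move=> bf [s_ [bs sf sy]]; have mf := measurable_sqnorm bf.
have [_ _ [M fM]] := bf.
have M0 : 0 <= M by exact: le_trans (Re_norm_ge0 (f 0)) (fM 0).
have /cvg_unique := nsq_cvg sy; apply => //.
pose K := fine (m setT).
have K0 : 0 <= K by rewrite fine_ge0.
apply/cvgrPdist_le => e e0.
(* [d <= 1] gives [|f| + |s_n| <= 2M + 1], so the squared moduli differ by at most [d (2M + 1)]; the
   second bound makes this, times the total mass [K], at most [e]. *)
pose d := Order.min 1 (e / ((2 * M + 1) * K + 1)).
have D0 : 0 < (2 * M + 1) * K + 1 by rewrite ltr_wpDl// mulr_ge0// addr_ge0// mulr_ge0.
have d0 : 0 < d by rewrite lt_min ltr01 divr_gt0.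
have d1 : d <= 1 by rewrite ge_min lexx.
have := sf d d0; apply: filterS => n dn.
rewrite nsq_simple_spectral_int_integral//.
have close t : `|sqnorm f t - sqnorm (s_ n) t| <= d * (2 * M + 1).
  have a0 := Re_norm_ge0 (f t); have b0 := Re_norm_ge0 (s_ n t).
  have ab : complex.Re `|f t| <= complex.Re `|s_ n t| + d.
    by apply: Re_norm_leD; rewrite distrC; exact: dn.
  have ba : complex.Re `|s_ n t| <= complex.Re `|f t| + d.
    by apply: Re_norm_leD; exact: dn.
  have := fM t; rewrite /sqnorm.
  move: a0 b0 ab ba; move: (complex.Re `|f t|) (complex.Re `|s_ n t|) => a b a0 b0 ab ba aM.
  rewrite subr_sqr normrM; apply: ler_pM => //.
    by rewrite ler_norml; lra.
  by rewrite ger0_norm ?addr_ge0//; lra.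
have if_ : m.-integrable setT (EFin \o sqnorm f).
  apply: (@bounded_measurable_integrable _ _ _ _ _ _ (M ^+ 2)) => // t _.
  rewrite ger0_norm ?sqr_ge0// lerXn2r ?nnegrE ?Re_norm_ge0//.
have ms := measurable_simple_sqnorm (bs n).
have is_ : m.-integrable setT (EFin \o sqnorm (s_ n)).
  apply: (@bounded_measurable_integrable _ _ _ _ _ _ (d * (2 * M + 1) + M ^+ 2)) => // t _.
  rewrite -[sqnorm (s_ n) t](subrK (sqnorm f t)) (le_trans (ler_normD _ _))// lerD//.
    by rewrite distrC.
  rewrite ger0_norm ?sqr_ge0// lerXn2r ?nnegrE ?Re_norm_ge0//.
rewrite -RintegralB//.
have mB : measurable_fun setT (fun t => sqnorm f t - sqnorm (s_ n) t).
  exact: measurable_funB.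
apply: le_trans (le_normr_Rintegral _ _) _ => //.
  exact: (@bounded_measurable_integrable _ _ _ _ _ _ (d * (2 * M + 1))).
apply: (@le_trans _ _ (\int[m]_t (d * (2 * M + 1)))).
  apply: le_Rintegral => //.
  - apply: (@bounded_measurable_integrable _ _ _ _ _ _ (d * (2 * M + 1))) => //.
      exact: measurableT_comp.
    by move=> t _; rewrite normr_id.
  - by apply: (@bounded_measurable_integrable _ _ _ _ _ _ `|d * (2 * M + 1)|).
rewrite Rintegral_cst// -/K -mulrA.
apply: (@le_trans _ _ (e / ((2 * M + 1) * K + 1) * ((2 * M + 1) * K))).
  by rewrite ler_wpM2r ?mulr_ge0 ?addr_ge0 ?mulr_ge0// ge_min lexx orbT.
rewrite mulrAC ler_pdivrMr// ler_pM2l// lerDl//.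
Qed.

End norm_of_spectral_integrals.

(** * Spectral projections and best approximation *)

Section spectral_projections.
Variables (R : realType) (H : completeNormedModType R[i]).
Variables (dot : {dot H for conjC}) (Hdot : is_hilbert dot).
Variables (E : set R -> {linear H -> H}) (HE : resolution_of_identity dot E).
Implicit Types (x y : H) (A D : set R) (f : R -> R[i]).

Lemma spectral_intP f D x : bounded_borel (patch (cst 0) D f) ->
  is_spectral_int E (patch (cst 0) D f) x (spectral_int E D f x).
Proof.
move=> bf; have [y Hy] := is_spectral_int_exists Hdot HE x bf.
exact: (@xgetPex _ 0 [set y | is_spectral_int E (patch (cst 0) D f) x y]) (ex_intro _ y Hy).
Qed.

(** [xget] may select a limit along any approximating sequence, so uniqueness has to be shown: the
    indicator of [D] is itself simple, and integrals of simple functions uniformly close to it are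
    close to [E D x]. *)
Lemma spectral_int_cst1 D x : measurable D -> spectral_int E D (cst 1) x = E D x.
Proof.
move=> mD; pose s : R -> R[i] := patch (cst 0) D (cst 1).
have mb (b : bool) : measurable ((fun t => t \in D) @^-1` [set b]).
  case: b.
    rewrite (_ : _ @^-1` _ = D)//; apply/seteqP; split => t /=.
      by move=> /set_mem.
    by move=> /mem_set.
  rewrite (_ : _ @^-1` _ = ~` D); first exact: measurableC.
  apply/seteqP; split => t /=; first by move=> /negbT; rewrite notin_setE.
  by move=> nD; apply/negbTE; rewrite notin_setE.
have sE t : s t = (fun b : bool => if b then 1 else 0) (t \in D).
  by rewrite /s /patch; case: ifP.
have bs : borel_simple s.
  split.
    apply: (@sub_finite_set _ _ [set 0; 1]); last exact: finite_set2.
    by move=> _ [t _ <-]; rewrite sE; case: (t \in D); [right|left].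
  move=> c.
  rewrite (_ : _ @^-1` _ = ((fun t => t \in D) @^-1` [set true] `&` [set t | c = 1])
    `|` ((fun t => t \in D) @^-1` [set false] `&` [set t | c = 0])).
    apply: measurableU; apply: measurableI => //.
      by have [->|c1] := pselect (c = 1);
        [rewrite (_ : mkset _ = setT)//; apply/seteqP; split
        |rewrite (_ : mkset _ = set0)//; apply/seteqP; split].
    by have [->|c1] := pselect (c = 0);
        [rewrite (_ : mkset _ = setT)//; apply/seteqP; split
        |rewrite (_ : mkset _ = set0)//; apply/seteqP; split].
  apply/seteqP; split => t /=; rewrite sE.
    by case: (t \in D) => <-; [left|right].
  by move=> [[-> ->]|[-> ->]].
have int_s : simple_spectral_int E s x = E D x.
  rewrite (@simple_spectral_int_factor _ _ _ _ HE _ [:: true; false] (fun t => t \in D)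
    (fun b : bool => if b then 1 else 0))//; last by move=> t; rewrite !inE; case: (t \in D).
  rewrite !big_cons big_nil scale1r scale0r !addr0; congr (E _ x).
  by apply/seteqP; split => t /=; [move=> /set_mem | move=> /mem_set].
pose S := [set y | is_spectral_int E s x y].
have SE : S (E D x).
  exists (fun=> s); split => //; last by rewrite int_s; exact: cvg_cst.
  by move=> e e0; apply: nearW => n t; rewrite subrr normr0 ler0c ltW.
rewrite /spectral_int; case: (xgetP 0 S) => [y yE|/(_ _ SE)//].
move=> [s_ [bs_ ss_ cs_]].
have : hnorm (y - E D x) = 0.
  have c1 : hnorm (simple_spectral_int E (s_ n) x - E D x) @[n --> \oo] --> hnorm (y - E D x).
    by apply: hnorm_cvg; apply: cvgB => //; exact: cvg_cst.
  have c2 : hnorm (simple_spectral_int E (s_ n) x - E D x) @[n --> \oo] --> (0 : R).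
    apply/cvgrPdist_le => e e0; pose d := e / (hnorm x + 1).
    have x1 : 0 < hnorm x + 1 by rewrite ltr_wpDl ?hnorm_ge0.
    have d0 : 0 < d by rewrite divr_gt0.
    have := ss_ d d0; apply: filterS => n dn.
    rewrite sub0r normrN ger0_norm ?hnorm_ge0// -int_s.
    apply: le_trans (simple_spectral_int_dist Hdot HE x (bs_ n) bs (ltW d0) dn) _.
    by rewrite mulrAC ler_pdivrMr// ler_pM2l// lerDl.
  exact: (cvg_unique _ c1 c2).
rewrite yE => n0; apply/eqP; rewrite -subr_eq0; apply/eqP.
by apply: nsq_eq0; rewrite /nsq n0 expr0n.
Qed.

(** The projection of [x] on the open interval belongs to [W E sigma], and the error it leaves is
    the projection on the complement. *)
Lemma best_approx_le (sigma : R) x :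
  best_approx E sigma x <= hnorm (E [set t | sigma <= `|t|] x).
Proof.
pose D := [set t : R | `|t| < sigma].
have mD : measurable D.
  rewrite (_ : D = `]- sigma, sigma[%classic); first exact: measurable_itv.
  by apply/seteqP; split => t; rewrite /D/= in_itv/= ltr_norml.
have DC : [set t | sigma <= `|t|] = ~` D.
  by apply/seteqP; split => t; rewrite /D/= leNgt => /negP.
have xE : x = E D x + E (~` D) x.
  rewrite -(proj_setU HE)// ?setICr// ?setUCr ?(proj_setT HE)//; exact: measurableC.
rewrite /best_approx; apply: ge_inf.
  by exists 0 => _ [z _ <-]; exact: hnorm_ge0.
exists (E D x); last by rewrite DC {1}xE addrAC subrr add0r.
by exists x => //; rewrite spectral_int_cst1.
Qed.

End spectral_projections.

(** * Averages of squared differences against the weight *)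

Section averages.
Variable R : realType.
Variables (psi V : R -> R) (K I gamma delta : R).
Hypothesis psi_cont : continuous psi.
Hypothesis psi_ge0 : forall t, 0 <= psi t.
Hypothesis psi_le : forall t, psi t <= K.
Hypothesis V_cont : continuous V.
Hypothesis V_ge0 : forall t, t \in `[0, 1] -> 0 <= V t.
Hypothesis V_int : \int[lebesgue_measure]_(t in `[0, 1]) V t = 1.
Hypothesis delta_gt0 : 0 < delta.
Hypothesis psi_V : forall u, gamma <= `|u| ->
  I <= \int[lebesgue_measure]_(s in `[0, 1]) (psi (u * s) * V s).
Hypothesis I_ge0 : 0 <= I.
Variable m : {finite_measure set R -> \bar R}.

Local Notation mu := (@lebesgue_measure R).

Let w t := V (t / delta).

Let w_cont : continuous w.
Proof.
have := @continuous_scale_arg R delta^-1 V V_cont.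
by under eq_fun do rewrite mulrC.
Qed.

Let w_ge0 t : t \in `[0, delta] -> 0 <= w t.
Proof.
rewrite in_itv/= => /andP[t0 td]; apply: V_ge0.
by rewrite in_itv/= divr_ge0 ?(ltW delta_gt0)//= ler_pdivrMr// mul1r.
Qed.

Lemma Rintegral_scale (f : R -> R) : continuous f ->
  \int[mu]_(t in `[0, delta]) f t = delta * \int[mu]_(s in `[0, 1]) f (delta * s).
Proof.
move=> cf; have [F dF] := continuous_primitive cf.
rewrite (Rintegral_is_derive (ltW delta_gt0) cf dF).
rewrite -RintegralZ_continuous; last exact: continuous_scale_arg.
have dG (s : R) : is_derive s 1 (fun s => F (delta * s)) (delta * f (delta * s)).
  exact: is_derive_scale_arg.
have cG : continuous (fun s => delta * f (delta * s)).
  by apply: continuous_mul; [exact: continuous_const | exact: continuous_scale_arg].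
by rewrite (Rintegral_is_derive ler01 cG dG) mulr1 mulr0.
Qed.

Let w_int : \int[mu]_(t in `[0, delta]) w t = delta.
Proof.
rewrite (Rintegral_scale w_cont) -[RHS]mulr1 -[X in _ = _ * X]V_int; congr (_ * _).
apply: eq_Rintegral => s _.
by rewrite /w mulrC mulKf// gt_eqF.
Qed.

Let y t := \int[m]_u psi (t * u).

Let mpsi t : measurable_fun setT (fun u : R => psi (t * u)).
Proof. by apply: continuous_measurable_fun; exact: continuous_scale_arg. Qed.

Let ipsi t : m.-integrable setT (fun u : R => (psi (t * u))%:E).
Proof.
apply: (@bounded_measurable_integrable _ _ _ _ _ _ K) => // u _.
by rewrite ger0_norm.
Qed.

Let yE t : (y t)%:E = (\int[m]_u (psi (t * u))%:E)%E.
Proof. by rewrite /y /Rintegral fineK//; exact: integrable_fin_num. Qed.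

Let y_ge0 t : 0 <= y t.
Proof. by apply: Rintegral_ge0. Qed.

Lemma Rintegral_dilation_le t : \int[m]_u psi (t * u) <= K * fine (m setT).
Proof.
rewrite -Rintegral_cst//; apply: le_Rintegral => //; first exact: ipsi.
apply: (@bounded_measurable_integrable _ _ _ _ _ _ `|K|) => //.
Qed.

Let y_le t : y t <= K * fine (m setT) := Rintegral_dilation_le t.

Let mpsi2 : measurable_fun setT (fun z : R * R => psi (z.1 * z.2)).
Proof.
apply: measurableT_comp; first exact: continuous_measurable_fun.
by apply: measurable_funM; [exact: measurable_fst | exact: measurable_snd].
Qed.

Let my : measurable_fun setT y.
Proof.
apply/measurable_EFinP.
rewrite (_ : EFin \o y = fubini_F m (fun z : R * R => (psi (z.1 * z.2))%:E)).
  apply: measurable_fun_fubini_tonelli_F; last by move=> z; rewrite lee_fin.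
  exact/measurable_EFinP.
by apply/funext => t /=; rewrite yE.
Qed.

Let segment_integrable (f : R -> R) (M : R) : measurable_fun setT f ->
  (forall t, t \in `[0, delta] -> `|f t| <= M) ->
  mu.-integrable `[0, delta] (EFin \o f).
Proof.
move=> mf fM; apply: (@bounded_measurable_integrable_on _ _ _ _ _ _ M) => //.
  by rewrite /= lebesgue_measure_itv/=; case: ifPn; rewrite ?ltry.
exact: measurable_funTS.
Qed.

Let mw : measurable_fun setT w. Proof. exact: continuous_measurable_fun. Qed.

Let w_bounded : exists2 W, 0 <= W & forall t, t \in `[0, delta] -> w t <= W.
Proof.
have [c c0 wc] := EVT_max (ltW delta_gt0) (continuous_subspaceT w_cont).
by exists (w c) => //; exact: w_ge0.
Qed.

Let weighted_integrable (f : R -> R) (M : R) : measurable_fun setT f ->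
  (forall t, t \in `[0, delta] -> 0 <= f t <= M) ->
  mu.-integrable `[0, delta] (EFin \o (fun t => f t * w t)).
Proof.
move=> mf fM; have [W W0 wW] := w_bounded.
apply: (@segment_integrable _ (M * W)); first exact: measurable_funM.
move=> t t0; have /andP[f0 fM'] := fM t t0.
by rewrite ger0_norm ?mulr_ge0 ?w_ge0// ler_pM ?w_ge0 ?wW.
Qed.

(** By Tonelli the average is an integral over [u] of dilated averages of [psi]. These are at least
    [I] when [|delta u| >= gamma], and nonnegative for the other [u]. *)
Lemma spectral_mass_le_average :
  I * fine (m [set u | gamma / delta <= `|u|]) <=
  delta^-1 * \int[mu]_(t in `[0, delta]) (y t * w t).
Proof.
set C := [set u | gamma / delta <= `|u|].
have mC : measurable C.
  rewrite (_ : C = (fun u => `|u|) @^-1` `[gamma / delta, +oo[%classic).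
    rewrite -[X in measurable X]setTI.
    by apply: continuous_measurable_fun => //; exact: norm_continuous.
  by apply/seteqP; split => u; rewrite /C/= in_itv/= andbT.
have iy : mu.-integrable `[0, delta] (EFin \o (fun t => y t * w t)).
  by apply: (@weighted_integrable _ (K * fine (m setT))) => // t _; rewrite y_ge0 y_le.
(* The indicator extends the integrand to the whole plane and keeps it nonnegative there, as [w] may
   be negative outside the segment. *)
pose g (z : R * R) : \bar R := (psi (z.1 * z.2) * w z.1 * \1_(`[0, delta]) z.1)%:E.
have mg : measurable_fun setT g.
  apply/measurable_EFinP; apply: measurable_funM; first apply: measurable_funM => //.
    by apply: measurableT_comp; [exact: mw | exact: measurable_fst].
  by apply: measurableT_comp; [exact: measurable_indic | exact: measurable_fst].
have g0 z : (0 <= g z)%E.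
  rewrite lee_fin indicE; case: (boolP (z.1 \in _)) => [|_]; last by rewrite mulr0.
  by move=> /set_mem/= zd; rewrite mulr1 mulr_ge0// w_ge0.
rewrite ler_pdivlMl// -lee_fin.
have -> : (\int[mu]_(t in `[0, delta]) (y t * w t))%:E = (\int[mu]_t \int[m]_u g (t, u))%E.
  rewrite /Rintegral fineK; last exact: integrable_fin_num.
  rewrite integral_mkcond; apply: eq_integral => t _.
  rewrite /patch; case: ifPn => td.
    under eq_integral do rewrite /g/= indicE td mulr1 EFinM muleC.
    rewrite ge0_integralZl//; first by rewrite -yE -EFinM mulrC.
    - exact/measurable_EFinP.
    - by move=> u _; rewrite lee_fin.
    - by rewrite lee_fin w_ge0//; move/set_mem: td.
  rewrite integral0_eq// => u _; rewrite /g/= indicE (negbTE td) mulr0//.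
have -> : (\int[mu]_t \int[m]_u g (t, u) = \int[m]_u \int[mu]_t g (t, u))%E.
  exact: (@fubini_tonelli _ _ _ _ R mu m g mg g0).
have -> : (delta * (I * fine (m C)))%:E = (\int[m]_u (delta * I * \1_C u)%:E)%E.
  under eq_integral do rewrite EFinM.
  rewrite ge0_integralZl//.
  - by rewrite integral_indic// setIT mulrA EFinM fineK// fin_num_measure.
  - by apply/measurable_EFinP; exact: measurable_indic.
  - by rewrite lee_fin mulr_ge0// ltW.
apply: ge0_le_integral => //.
- by move=> u _; rewrite lee_fin !mulr_ge0// ltW.
- by apply/measurable_EFinP; apply: measurable_funM => //; exact: measurable_indic.
- exact: (@measurable_fun_fubini_tonelli_G _ _ _ _ R mu g mg g0).
move=> u _; rewrite indicE; case: (boolP (u \in C)) => [/set_mem uC|_]; last first.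
  by rewrite mulr0 integral_ge0.
have cpw : continuous (fun t : R => psi (t * u) * w t).
  apply: continuous_mul w_cont.
  by under eq_fun do rewrite mulrC; exact: continuous_scale_arg.
have -> : (\int[mu]_t g (t, u))%E = (\int[mu]_(t in `[0, delta]) (psi (t * u) * w t))%:E.
  rewrite /Rintegral fineK; last by apply: integrable_fin_num => //; exact: continuous_integrable.
  rewrite [RHS]integral_mkcond; apply: eq_integral => t _.
  by rewrite /g/= /patch indicE; case: ifP => _; rewrite ?mulr1 ?mulr0.
rewrite lee_fin mulr1 Rintegral_scale// ler_pM2l//.
have -> : \int[mu]_(s in `[0, 1]) (psi (delta * s * u) * w (delta * s)) =
    \int[mu]_(s in `[0, 1]) (psi (delta * u * s) * V s).
  apply: eq_Rintegral => s _; rewrite /w [delta * s / delta]mulrC mulKf ?gt_eqF//.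
  by rewrite mulrAC.
by apply: psi_V; rewrite normrM gtr0_norm// mulrC -ler_pdivrMr//; exact: uC.
Qed.

Lemma average_le_sup (S : R) : (forall t, t \in `[0, delta] -> y t <= S) ->
  delta^-1 * \int[mu]_(t in `[0, delta]) (y t * w t) <= S.
Proof.
move=> yS; rewrite ler_pdivrMl// mulrC.
have -> : S * delta = \int[mu]_(t in `[0, delta]) (S * w t).
  by rewrite RintegralZ_continuous// w_int.
apply: le_Rintegral => //.
- by apply: (@weighted_integrable _ (K * fine (m setT))) => // t _; rewrite y_ge0 y_le.
- apply: continuous_integrable; apply: continuous_mul => //; exact: continuous_const.
- by move=> t t0; rewrite ler_wpM2r ?yS ?w_ge0.
Qed.

(** The graph of [a^r] lies above its tangent at 1: this is Young's inequality for [a] and 1,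
    multiplied by [r]. *)
Lemma powR_tangent (r a : R) : 1 <= r -> 0 <= a -> r * a <= a `^ r + (r - 1).
Proof.
move=> r1 a0; have r0 : 0 < r by exact: lt_le_trans r1.
move: r1; rewrite le_eqVlt => /predU1P[<-|r1].
  by rewrite powRr1// mul1r subrr addr0.
pose q := (1 - r^-1)^-1.
have q0 : 0 < q by rewrite invr_gt0 subr_gt0 invf_lt1.
have := @conjugate_powR _ a 1 r q a0 ler01 r0 q0.
rewrite invrK addrC subrK powR1 mulr1 mul1r => /(_ erefl) H.
rewrite -(ler_pM2l (_ : 0 < r^-1)) ?invr_gt0// mulKf ?gt_eqF//.
by rewrite mulrDr mulrBr mulVf ?gt_eqF// mulr1 [r^-1 * _]mulrC.
Qed.

(* Jensen's inequality: integrate the tangent line of [a |-> a^r] at [Y]. *)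
Lemma power_mean (r Y : R) : 1 <= r -> 0 <= Y ->
  Y <= delta^-1 * \int[mu]_(t in `[0, delta]) (y t * w t) ->
  Y `^ r <= delta^-1 * \int[mu]_(t in `[0, delta]) (y t `^ r * w t).
Proof.
move=> r1 Y0 YA; have r0 : 0 < r by exact: lt_le_trans r1.
have [->|Yn0] := eqVneq Y 0.
  rewrite powR0 ?gt_eqF// mulr_ge0 ?invr_ge0 ?(ltW delta_gt0)//.
  by apply: Rintegral_ge0 => t td; rewrite mulr_ge0 ?powR_ge0 ?w_ge0.
have {Yn0}Y0 : 0 < Y by rewrite lt_neqAle eq_sym Yn0.
pose a := Y `^ r; have a0 : 0 < a by exact: powR_gt0.
have iy : mu.-integrable `[0, delta] (EFin \o (fun t => y t * w t)).
  by apply: (@weighted_integrable _ (K * fine (m setT))) => // t _; rewrite y_ge0 y_le.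
have iyr : mu.-integrable `[0, delta] (EFin \o (fun t => y t `^ r * w t)).
  apply: (@weighted_integrable _ ((K * fine (m setT)) `^ r)).
    exact: (measurableT_comp (measurable_powR r) my).
  move=> t _; rewrite powR_ge0/=; apply: ge0_ler_powR; first exact: ltW.
  - by rewrite nnegrE.
  - by rewrite nnegrE; exact: le_trans (y_ge0 0) (y_le 0).
  - exact: y_le.
have iw : mu.-integrable `[0, delta] (EFin \o w) by exact: continuous_integrable.
(* The tangent at [Y] is [c1 + c2 * y], with intercept [Y^r (1 - r)] and slope [r Y^(r-1)]. *)
pose c1 := a * (1 - r); pose c2 := a * r / Y.
have i1 : mu.-integrable `[0, delta] (EFin \o (fun t => c1 * w t)).
  by apply: continuous_integrable; apply: continuous_mul => //; exact: continuous_const.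
have i2 : mu.-integrable `[0, delta] (EFin \o (fun t => c2 * (y t * w t))).
  have := @integrableZl _ _ R mu `[0, delta]%classic (measurable_itv _) c2 _ iy.
  exact.
have key : \int[mu]_(t in `[0, delta]) (c1 * w t + c2 * (y t * w t)) <=
    \int[mu]_(t in `[0, delta]) (y t `^ r * w t).
  apply: le_Rintegral => //.
    exact: (@integrableD _ _ R mu `[0, delta]%classic (measurable_itv _) _ _ i1 i2).
  move=> t td; rewrite mulrA -mulrDl ler_wpM2r ?w_ge0//.
  have yY : 0 <= y t / Y by rewrite divr_ge0 ?y_ge0// ltW.
  have := powR_tangent r1 yY.
  have -> : y t `^ r = a * (y t / Y) `^ r.
    by rewrite /a -powRM ?(ltW Y0)// mulrC divfK// gt_eqF.
  rewrite /c1 /c2 -!mulrA -mulrDr ler_pM2l// [Y^-1 * _]mulrC; lra.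
rewrite RintegralD// RintegralZl// w_int RintegralZl// in key.
rewrite ler_pdivlMl//; apply: le_trans key; rewrite ler_pdivlMl// in YA.
(* Since the slope [c2] is nonnegative, it suffices that [Y] be at most the average. *)
have : c2 * (delta * Y) <= c2 * \int[mu]_(t in `[0, delta]) (y t * w t).
  by rewrite ler_wpM2l// /c2 divr_ge0 ?mulr_ge0 ?ltW.
have -> : c2 * (delta * Y) = a * r * delta by rewrite /c2 [delta * Y]mulrC mulrA divfK// gt_eqF.
rewrite -/a /c1; lra.
Qed.

End averages.

(** * Norms of generalised differences *)

Section generalized_differences.
Variable R : realType.
Variable phi : R[i] -> R[i].
Hypothesis phi_cont : continuous (phi : R[i]^o -> R[i]^o).

Lemma normc_parts_ge (z : R[i]) (e : R) : `|z| <= e%:C%C ->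
  `|complex.Re z| <= e /\ `|complex.Im z| <= e.
Proof.
move=> ze; have h : complex.Re `|z| <= e by move: ze; rewrite lecE => /andP[].
by have [zr zi] := Re_normc_ge z; split; [exact: le_trans zr h|exact: le_trans zi h].
Qed.

Lemma symbol_near (t0 e : R) : 0 < e ->
  \forall t \near t0, `|phi (cis t0) - phi (cis t)| <= e%:C%C.
Proof.
move=> e0; have e0' : 0 < e%:C%C :> R[i] by rewrite ltcR.
have /cvgrPdist_le/(_ _ e0') := @phi_cont (cis t0).
move=> /nbhs_ballP[d /= d0 Hd].
have [d' d'0 dE] : exists2 d' : R, 0 < d' & d = d'%:C%C.
  case: d d0 {Hd} => a b; rewrite ltcE/= => /andP[/eqP -> a0].
  by exists a.
(* A third for each of the two parts, so that the non-strict bounds add up to strictly less than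
   [d']. *)
have d2 : 0 < d' / 3 by rewrite divr_gt0.
have /cvgrPdist_le/(_ _ d2) := @continuous_cos R t0.
have /cvgrPdist_le/(_ _ d2) := @continuous_sin R t0.
apply: filterS2 => t st ct; apply: Hd; rewrite /ball/= dE.
apply: (@le_lt_trans _ _ (d' / 3 + d' / 3)%:C%C).
  by apply: normc_le_parts.
by rewrite ltcR; lra.
Qed.

Lemma symbol_Re_continuous : continuous (fun t => complex.Re (phi (cis t))).
Proof.
move=> t0; apply/cvgrPdist_le => e e0; have := symbol_near t0 e0.
apply: filterS => t /normc_parts_ge[+ _].
by case: (phi (cis t0)) (phi (cis t)) => [a b] [c d].
Qed.

Lemma symbol_Im_continuous : continuous (fun t => complex.Im (phi (cis t))).
Proof.
move=> t0; apply/cvgrPdist_le => e e0; have := symbol_near t0 e0.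
apply: filterS => t /normc_parts_ge[_].
by case: (phi (cis t0)) (phi (cis t)) => [a b] [c d].
Qed.

Lemma bounded_borel_symbol (K t : R) : (forall u, sq_symbol phi u <= K) ->
  bounded_borel (fun u : R => phi (cis (t * u))).
Proof.
move=> sK; split.
- apply: continuous_measurable_fun.
  exact: (continuous_scale_arg symbol_Re_continuous).
- apply: continuous_measurable_fun.
  exact: (continuous_scale_arg symbol_Im_continuous).
- exists (Num.sqrt K) => u; rewrite -[leLHS]ger0_norm ?Re_norm_ge0// -sqrtr_sqr.
  by apply: ler_wsqrtr; exact: sK.
Qed.

Variables (H : completeNormedModType R[i]).
Variables (dot : {dot H for conjC}) (Hdot : is_hilbert dot).
Variables (E : set R -> {linear H -> H}) (HE : resolution_of_identity dot E).

Lemma nsq_gen_diff (K t : R) (x : H) (m : {finite_measure set R -> \bar R}) :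
  (forall u, sq_symbol phi u <= K) -> (forall A, m A = (nsq (E A x))%:E) ->
  nsq (gen_diff E phi t x) = \int[m]_u sq_symbol phi (t * u).
Proof.
move=> sK mE; have bf := bounded_borel_symbol t sK.
have pE : patch (cst 0) setT (fun u : R => phi (cis (t * u))) = (fun u => phi (cis (t * u))).
  by apply/funext => u; rewrite /patch in_setT.
rewrite (nsq_spectral_int Hdot HE mE bf)// -[X in is_spectral_int _ X]pE.
by apply: (spectral_intP Hdot HE); rewrite pE.
Qed.

End generalized_differences.

(** * The Jackson-type estimates *)

Theorem mainTheorem6 (R : realType) (H : completeNormedModType R[i])
    (dot : {dot H for conjC}) (Hdot : is_hilbert dot)
    (E : set R -> {linear H -> H}) (HE : resolution_of_identity dot E)
    (phi : R[i] -> R[i]) (phi_cont : continuous (phi : R[i]^o -> R[i]^o))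
    (phi_Phi : in_Phi (sq_symbol phi)) :
  exists (gamma : R) (V : R -> R),
    [/\ 0 < gamma,
        is_weight V,
        mean (sq_symbol phi) <=
          inf [set \int[lebesgue_measure]_(s in `[0, 1])
                     (sq_symbol phi (t * s) * V s)
              | t in [set t : R | gamma <= `|t|]] &
        forall (x : H) (sigma : R), 0 < sigma ->
          (forall p : \bar R, (2%:E <= p)%E ->
             best_approx E sigma x <=
               (Num.sqrt (mean (sq_symbol phi)))^-1 *
               modulus_Lp E phi x p V (gamma / sigma)) /\
          best_approx E sigma x <=
            (Num.sqrt (mean (sq_symbol phi)))^-1 *
            modulus E phi x (gamma / sigma)].
Proof.
have [gamma [V [gamma0 wV cV psi_V]]] := exists_weight phi_Phi.
have I0 := mean_gt0 phi_Phi.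
have [cpsi psi0 ppsi _ _] := phi_Phi.
have [K K0 psiK] := periodic_bounded cpsi ppsi.
have [V0 _ _ V1] := wV.
have psi_le u : sq_symbol phi u <= K by exact: le_trans (ler_norm _) (psiK u).
set I := mean _ in I0 psi_V *.
exists gamma, V; split => //.
  apply: lb_le_inf.
    by eexists; exists gamma => //=; rewrite ger0_norm// ltW.
  by move=> _ [t gt <-]; exact: psi_V.
move=> x sigma s0; pose delta := gamma / sigma.
have delta0 : 0 < delta by exact: divr_gt0.
have [m mE] := spectral_measure_exists Hdot HE x.
pose y t := \int[m]_u sq_symbol phi (t * u).
have yE t : nsq (gen_diff E phi t x) = y t.
  exact: (nsq_gen_diff phi_cont Hdot HE t psi_le mE).
have hE t : hnorm (gen_diff E phi t x) = Num.sqrt (y t) by rewrite hnorm_sqrt yE.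
have y_ge0 t : 0 <= y t by rewrite -yE nsq_ge0.
have y_le t : y t <= K * fine (m setT) by exact: Rintegral_dilation_le.
pose C := [set t : R | sigma <= `|t|].
have CE : C = [set t | gamma / delta <= `|t|].
  by rewrite /delta invf_div mulrCA mulfV ?mulr1// gt_eqF.
pose Y := I * nsq (E C x).
have Y0 : 0 <= Y by rewrite mulr_ge0 ?nsq_ge0// ltW.
have avg : Y <= delta^-1 *
    \int[lebesgue_measure]_(t in `[0, delta]) (y t * V (t / delta)).
  have := spectral_mass_le_average cpsi psi0 psi_le cV V0 delta0 psi_V (ltW I0) m.
  by rewrite -CE mE.
(* [Y] is [I] times the squared norm of the spectral part of [x] at [|s| >= sigma], so every case
   amounts to bounding [sqrt Y] by the modulus. *)
have reduce (M : R) : Num.sqrt Y <= M -> best_approx E sigma x <= (Num.sqrt I)^-1 * M.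
  move=> YM; apply: le_trans (best_approx_le Hdot HE sigma x) _.
  rewrite ler_pdivlMl ?sqrtr_gt0// hnorm_sqrt -sqrtrM; last exact: ltW.
  exact: YM.
have sup_case : best_approx E sigma x <= (Num.sqrt I)^-1 * modulus E phi x delta.
  apply: reduce; pose S := modulus E phi x delta.
  have hS t : t \in `[0, delta] -> hnorm (gen_diff E phi t x) <= S.
    move=> td; apply: ub_le_sup; last by exists t.
    exists (Num.sqrt (K * fine (m setT))) => _ [u _ <-].
    by rewrite hE; exact: ler_wsqrtr.
  have S0 : 0 <= S.
    apply: le_trans (hnorm_ge0 _) (hS 0 _).
    by rewrite in_itv/= lexx ltW.
  rewrite -[leRHS]ger0_norm// -sqrtr_sqr; apply: ler_wsqrtr.
  apply: le_trans avg _; apply: (average_le_sup cpsi psi0 psi_le cV V0 V1 delta0) => // t td.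
  rewrite -/(y t) -yE /nsq lerXn2r ?nnegrE ?hnorm_ge0//; exact: hS.
split => // -[q|//|//] /=; rewrite lee_fin => q2.
apply: reduce; have q0 : 0 < q by exact: lt_le_trans q2.
(* [y] is the squared norm of the difference, so its [q]-th power is [y^r]; [q >= 2] is what makes
   Jensen's inequality applicable. *)
pose r := q / 2; have r1 : 1 <= r by rewrite ler_pdivlMr// mul1r.
have pm := power_mean cpsi psi0 psi_le cV V0 V1 delta0 r1 Y0 avg.
have -> : \int[lebesgue_measure]_(t in `[0, delta])
    (hnorm (gen_diff E phi t x) `^ q * V (t / delta)) =
  \int[lebesgue_measure]_(t in `[0, delta]) (y t `^ r * V (t / delta)).
  apply: eq_Rintegral => t _; congr (_ * _).
  by rewrite hE -powR12_sqrt// -powRrM mulrC.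
have -> : Num.sqrt Y = (Y `^ r) `^ q^-1.
  by rewrite -powR12_sqrt// -powRrM /r mulrAC mulfV ?mul1r// gt_eqF.
apply: ge0_ler_powR; rewrite ?nnegrE ?powR_ge0 ?invr_ge0 ?(ltW q0)//.
exact: le_trans (powR_ge0 _ _) pm.
Qed.
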